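(* (Dwork lemma.) Let $G$ be a profinite group, $H$ an open subgroup, and $S$ a truncation set for $H$. Let $T=\mathbb{Z}[X]$ be the free commutative ring on a set $X$ and $Q=T(Y)$ the free $T$-module on a set $Y$. For an element $a\in\mathrm{gh}^S_{H\le G}(T;Q)=\big(\prod_{U\in S}Q^{\otimes_T G/U}\big)^H$, the following are equivalent: (i) $a$ is in the image of the ghost map $w:\prod_{V\in\underline{S}}Q^{\otimes_T G/V}\to\mathrm{gh}^S_{H\le G}(T;Q)$; (ii) for all subgroups $U\in S$, the element $$\sum_{vU\in N_H(U)/U}\phi_U^{\langle vU\rangle}\big(a_{\langle vU\rangle}\big)\in Q^{\otimes_T G/U}$$ is in the image of $\mathrm{tr}_U^{N_H(U)}:Q^{\otimes_T G/U}\to Q^{\otimes_T G/U}$. Here $\langle vU\rangle$ denotes the subgroup of $N_H(U)$ generated by the elements of the coset $vU$.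
   Context: $V\le_o G$ means $V$ is an open subgroup. A truncation set for $H$ is a set $S$ of open subgroups of $H$ closed under $H$-conjugation and upwards closed among open subgroups of $H$. $\underline{S}\subseteq S$ is a chosen set of representatives of the $H$-conjugacy classes in $S$, and for each $V\in\underline{S}$ coset representatives for $G/V$ are chosen. $N_H(U)$ is the normaliser of $U$ in $H$. For a finite set $Z$, $Q^{\otimes_T Z}$ is the tensor power over $T$ indexed by $Z$. For $V\le_o G$, $g\in G$, the isomorphism $g\cdot(-):Q^{\otimes_T G/V}\to Q^{\otimes_T G/gVg^{-1}}$ sends $\bigotimes_{aV}m_{aV}$ to the tensor whose factor at the coset $a(gVg^{-1})$ is $m_{agV}$. These maps define the $H$-action on $\prod_{U\in S}Q^{\otimes_T G/U}$ and an action of $N_H(U)/U$ on $Q^{\otimes_T G/U}$; $\mathrm{tr}_U^{N_H(U)}(x)=\sum_{aU\in N_H(U)/U}a\cdot x$. For $U\le_o V\le_o G$ and coset representatives $\{g_i\}$ of $G/V$, $f_{G/V}:Q^{\otimes_T G/V\times V/U}\to Q^{\otimes_T G/U}$ is induced by the bijection $G/V\times V/U\to G/U$, $(g_iV,sU)\mapsto g_isU$. For $n\in Q^{\otimes_T G/V}$, $n^{\otimes_T V/U}\in Q^{\otimes_T G/V\times V/U}$ is its tensor power indexed by $V/U$. The ghost map $w$ has components $$w_U(n)=\sum_{V\in\underline{S}}\ \sum_{hV\in (H/V)^U}h\cdot f_{G/V}\big(n_V^{\otimes_T V/h^{-1}Uh}\big)\quad(U\in S),\qquad (H/V)^U=\{hV: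 h^{-1}Uh\le V\}.$$ Frobenius lift. For $k\in\mathbb{N}$ let $\varphi_k:\mathbb{Z}[X]\to\mathbb{Z}[X]$ be the ring homomorphism with $x\mapsto x^k$ for $x\in X$. For $U\le_o V\le_o G$ the additive map $\phi_U^V:Q^{\otimes_T G/V}\to Q^{\otimes_T G/U}$ is defined, using $Q^{\otimes_T G/V}\cong T(Y^{\times G/V})$, by $$\sum_{j}r_j\bigotimes_{gV\in G/V}y^j_{gV}\ \longmapsto\ \sum_j\varphi_{|V:U|}(r_j)\bigotimes_{gU\in G/U}y^j_{gV}\qquad(r_j\in T,\ y^j_{gV}\in Y).$$ *)

(* Defs.v *)
From HB Require Import structures.
From mathcomp Require Import all_boot all_algebra finmap.
From mathcomp Require Import multinomials.monalg.
From mathcomp Require Import boolp classical_sets functions cardinality fsbigop.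
From mathcomp Require Import topology.

Set Implicit Arguments.
Unset Strict Implicit.
Unset Printing Implicit Defensive.

Import GRing.Theory.

Local Open Scope classical_set_scope.
Local Open Scope quotient_scope.
Local Open Scope ring_scope.

(* [tpow M Z] is the quotient of the free [T]-module on the families [Z -> M] by
   the multilinearity relations; [tlift_tens], [tlift_linear] and
   [tpow_linear_ext] give its universal property. *)
Section TensorPower.
Variables (T : comNzRingType) (M : lmodType T) (Z : choiceType).

Definition upd (m : Z -> M) (z : Z) (u : M) : Z -> M :=
  fun z' => if z' == z then u else m z'.

Definition multilinear (N : lmodType T) (f : (Z -> M) -> N) : Prop :=
  forall (m : Z -> M) (z : Z) (r : T) (u v : M),
    f (upd m z (r *: u + v)) =
    r *: f (upd m z u) + f (upd m z v).

Definition free_tens := {malg T[Z -> M]}.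

Definition tensor_relation : set free_tens := [set x | exists m z r u v,
  x = << upd m z (r *: u + v) >> - r *: << upd m z u >>
      - << upd m z v >>].

Definition submod_set (P : set free_tens) : Prop :=
  P 0 /\ forall r x y, P x -> P y -> P (r *: x + y).

Definition tens_null : {pred free_tens} := fun x =>
  `[< forall P, submod_set P -> tensor_relation `<=` P -> P x >].

Lemma tens_null_closed r x y :
  x \in tens_null -> y \in tens_null -> r *: x + y \in tens_null.
Proof.
move=> /asboolP hx /asboolP hy; apply/asboolP => P PS PR.
by apply: PS.2; [exact: hx | exact: hy].
Qed.

Lemma tens_null0 : 0 \in tens_null.
Proof. by apply/asboolP => P PS _; case: PS. Qed.

Lemma tens_null_zmod : zmod_closed tens_null.
Proof.
split=> [|x y xN yN]; first exact: tens_null0.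
by rewrite addrC -scaleN1r tens_null_closed.
Qed.

HB.instance Definition _ :=
  GRing.isZmodClosed.Build free_tens tens_null tens_null_zmod.

Definition tpow := Quotient.quot tens_null.
HB.instance Definition _ := GRing.Zmodule.on tpow.

Local Notation pi := (\pi_tpow).

Lemma tpow_piP (x y : free_tens) : (pi x = pi y) <-> (x - y \in tens_null).
Proof.
split=> [e|]; first by rewrite Quotient.idealrBE; apply/eqP.
by rewrite Quotient.idealrBE => /eqP.
Qed.

Lemma tpow_piD x y : pi (x + y) = pi x + pi y.
Proof. by rewrite !piE. Qed.

Definition tpow_scale (r : T) (x : tpow) : tpow := pi (r *: repr x).

Lemma tpow_piZ r x : pi (r *: x) = tpow_scale r (pi x).
Proof.
apply/tpow_piP; rewrite -scalerBr -[_ *: _]addr0 tens_null_closed ?tens_null0//.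
by apply/tpow_piP; rewrite reprK.
Qed.

Lemma tpow_surj (x : tpow) : exists y, x = pi y.
Proof. by exists (repr x); rewrite reprK. Qed.

Lemma tpow_scaleA a b x : tpow_scale a (tpow_scale b x) = tpow_scale (a * b) x.
Proof.
have [y ->] := tpow_surj x.
by rewrite -[tpow_scale b _]tpow_piZ -[LHS]tpow_piZ -[RHS]tpow_piZ scalerA.
Qed.

Lemma tpow_scale1 : left_id 1 tpow_scale.
Proof.
by move=> x; have [y ->] := tpow_surj x; rewrite -[LHS]tpow_piZ scale1r.
Qed.

Lemma tpow_scaleDr : right_distributive tpow_scale +%R.
Proof.
move=> a x y; have [[x' ->] [y' ->]] := (tpow_surj x, tpow_surj y).
rewrite -tpow_piD -[LHS]tpow_piZ -[tpow_scale a (pi x')]tpow_piZ.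
by rewrite -[tpow_scale a (pi y')]tpow_piZ -tpow_piD scalerDr.
Qed.

Lemma tpow_scaleDl x : {morph tpow_scale^~ x : a b / a + b}.
Proof.
move=> a b; have [y ->] := tpow_surj x.
rewrite -[LHS]tpow_piZ -[tpow_scale a (pi y)]tpow_piZ.
by rewrite -[tpow_scale b (pi y)]tpow_piZ -tpow_piD scalerDl.
Qed.

HB.instance Definition _ := GRing.Zmodule_isLmodule.Build T tpow
  tpow_scaleA tpow_scale1 tpow_scaleDr tpow_scaleDl.

Lemma tpow_pi_linear r x y : pi (r *: x + y) = r *: (pi x : tpow) + pi y.
Proof. by rewrite tpow_piD tpow_piZ. Qed.

(* the pure tensor with factors [m z] *)
Definition tens (m : Z -> M) : tpow := pi << m >>.

Lemma tens_multilinear : multilinear tens.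
Proof.
move=> m z r u v; rewrite /tens.
have -> : forall x y : tpow, r *: x + y = tpow_scale r x + y by [].
rewrite -tpow_piZ -tpow_piD; apply/tpow_piP/asboolP => P _; apply.
by exists m, z, r, u, v; rewrite opprD addrA.
Qed.

Section Lift.
Variable N : lmodType T.

(* the linear extension of [f], meaningful for multilinear [f] *)
Definition free_lift (f : (Z -> M) -> N) (x : free_tens) : N :=
  \sum_(m <- msupp x) x@_m *: f m.

Definition tlift (f : (Z -> M) -> N) (x : tpow) : N := free_lift f (repr x).

Lemma free_liftEw f (d : {fset (Z -> M)}) x : (msupp x `<=` d)%fset ->
  free_lift f x = \sum_(m <- d) x@_m *: f m.
Proof.
move=> le; rewrite [LHS](big_fset_incl _ le) // => m _ /mcoeff_outdom ->.
by rewrite scale0r.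
Qed.

Lemma free_liftP f r x y :
  free_lift f (r *: x + y) = r *: free_lift f x + free_lift f y.
Proof.
pose d := (msupp x `|` msupp y `|` msupp (r *: x + y))%fset.
have sub z : (z = x) \/ (z = y) \/ (z = r *: x + y) -> (msupp z `<=` d)%fset.
  move=> h; apply/fsubsetP => i; rewrite !in_fsetU.
  by case: h => [->|[->|->]] ->; rewrite ?orbT.
rewrite !(@free_liftEw f d) ?sub; auto.
rewrite scaler_sumr -big_split; apply: eq_bigr => m _ /=.
by rewrite mcoeffD mcoeffZ scalerDl scalerA.
Qed.

Lemma free_liftU f m : free_lift f << m >> = f m.
Proof.
by rewrite (free_liftEw f (d := [fset m]%fset)) ?msuppU_le // big_seq_fset1
  mcoeffUU scale1r.
Qed.

Lemma free_lift_pi f x : multilinear f -> tlift f (pi x) = free_lift f x.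
Proof.
move=> mf; pose P : set free_tens := [set y | free_lift f y = 0].
suff: P (repr (pi x) - x).
  rewrite /P /= -scaleN1r addrC free_liftP scaleN1r addrC => /eqP.
  by rewrite subr_eq0 => /eqP.
have : repr (pi x) - x \in tens_null by apply/tpow_piP; rewrite reprK.
move/asboolP; apply.
  split=> [|r y z]; rewrite /P /=.
    by have := free_liftP f (-1) 0 0; rewrite scaler0 addr0 scaleN1r addNr.
  by rewrite free_liftP => -> ->; rewrite scaler0 addr0.
move=> _ [m [z [r [u [v ->]]]]]; rewrite /P /=.
rewrite -addrA addrC -opprD -scaleN1r !free_liftP !free_liftU mf.
by rewrite scaleN1r addNr.
Qed.

Lemma tlift_linear f : multilinear f -> linear (tlift f).
Proof.
move=> mf r x y; have [[x' ->] [y' ->]] := (tpow_surj x, tpow_surj y).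
by rewrite -tpow_pi_linear !free_lift_pi// free_liftP.
Qed.

Lemma tlift_tens f m : multilinear f -> tlift f (tens m) = f m.
Proof. by move=> mf; rewrite free_lift_pi// free_liftU. Qed.

Lemma tpow_linear_ext (f g : tpow -> N) : linear f -> linear g ->
  (forall m, f (tens m) = g (tens m)) -> f = g.
Proof.
move=> lf lg fg; apply/funext => x; have [y ->] := tpow_surj x.
have lin0 h : linear h -> h 0 = 0 :> N.
  by move=> lh; have := lh (-1) 0 0; rewrite scaler0 addr0 scaleN1r addNr.
rewrite [y]monalgE; elim: (enum_fset (msupp y)) => [|m s ih].
  have p0 : pi 0 = 0 :> tpow by rewrite piE.
  by rewrite big_nil p0 !lin0.
rewrite big_cons; have -> : << y@_m *g m >> = y@_m *: << m >> :> free_tens.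
  by apply/malgP => k; rewrite mcoeffZ !mcoeffU mulrnAr mulr1.
by rewrite tpow_pi_linear lf lg ih fg.
Qed.

End Lift.
End TensorPower.

Arguments tens {T M Z} m.
Arguments tlift {T M Z N} f x.

(* The inverse of an isomorphism. It is used below for [coset_prod] with
   [U <= V], and for [tpow_curry] and [tpow_basis] with finite index sets and
   free modules, where the maps are bijective and the default 0 is not used. *)
Definition inv_iso (A B : nmodType) (f : A -> B) (y : B) : A :=
  xget 0 [set x | f x = y].

Section TensorMaps.
Variables (T : comNzRingType) (M : lmodType T).

(* For bijective [e], the tensor with factors [m z] is sent to the tensor whose
   factor at [z'] is [m (e z')]. *)
Definition tpow_reindex (Z Z' : choiceType) (e : Z' -> Z) :
    tpow M Z -> tpow M Z' :=
  tlift (fun m : Z -> M => tens (m \o e)).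

(* the canonical isomorphism to the iterated tensor power *)
Definition tpow_curry (A B : choiceType) :
    tpow M (A * B)%type -> tpow (tpow M A) B :=
  tlift (fun m : A * B -> M => tens (fun b => tens (fun a => m (a, b)))).

(* the tensor power of [n] indexed by [B], seen in [tpow M (A * B)] *)
Definition tens_power (A B : choiceType) (n : tpow M A) : tpow M (A * B)%type :=
  inv_iso (@tpow_curry A B) (tens (fun _ : B => n)).

End TensorMaps.

(* the free commutative ring on [X]; its variables are [<< ucm x >>] *)
Notation freeCRing X := {malg int[{cmonom X}]}.

Section Frobenius.
Variable X : choiceType.
Local Notation T := (freeCRing X).

Definition monom_pow (k : nat) (m : {cmonom X}) : T := << m >> ^+ k.

Lemma monom_pow_mmorphism k : mmorphism (monom_pow k).
Proof.
split=> [m1 m2|]; last by rewrite /monom_pow expr1n.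
by rewrite /monom_pow -exprMn malgM_def fgmulUU mulr1.
Qed.

HB.instance Definition _ k :=
  isMultiplicative.Build {cmonom X} T (monom_pow k) (monom_pow_mmorphism k).

Definition frob (k : nat) : {rmorphism T -> T} :=
  mmap (intr : int -> T) (monom_pow k).

Lemma frobX k (x : X) : frob k << ucm x >> = << ucm x >> ^+ k.
Proof. by rewrite /frob /= mmapU mul1r. Qed.

End Frobenius.

Arguments frob {X} k.

Section FreeTensor.
Variables (X Y : choiceType).
Local Notation T := (freeCRing X).
Local Notation Q := {malg T[Y]}.

(* the isomorphism [T(Y^Z) -> Q^{\otimes_T Z}], for finite [Z] *)
Definition tpow_basis (Z : choiceType) (p : {malg T[Z -> Y]}) : tpow Q Z :=
  \sum_(y <- msupp p) p@_y *: tens (fun z => << y z >> : Q).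

End FreeTensor.

HB.mixin Record Group_isTopological G of Group G & Topological G := {
  mulg_continuous : continuous (fun xy : G * G => (xy.1 * xy.2)%g);
  invg_continuous : continuous (fun x : G => x^-1%g)
}.

#[short(type="topologicalGroupType")]
HB.structure Definition TopologicalGroup :=
  {G of Group G & Topological G & Group_isTopological G}.

HB.mixin Record TopologicalGroup_isProfinite G of TopologicalGroup G := {
  profinite_compact : compact [set: G];
  profinite_hausdorff : hausdorff_space G;
  profinite_disconnected : totally_disconnected [set: G]
}.

#[short(type="profiniteGroupType")]
HB.structure Definition ProfiniteGroup :=
  {G of TopologicalGroup G & TopologicalGroup_isProfinite G}.

Local Open Scope group_scope.

Section Groups.
Variable G : groupType.
Implicit Types (A U V H c : set G).

Definition subgroup V : Prop := group_closed (mem V).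

Definition gen_subgroup A : set G :=
  [set x | forall V, subgroup V -> A `<=` V -> V x].

Definition conj_set (g : G) U : set G := [set g * u * g^-1 | u in U].

Definition left_coset (g : G) U : set G := [set g * u | u in U].

Definition left_cosets A U : set (set G) := [set left_coset g U | g in A].

Definition mk_coset (g : G) U : left_cosets [set: G] U :=
  SigSub (mem_set (ex_intro2 _ _ g I erefl)).

Definition coset_rep c : G := xget 1 c.

Definition coset_index V U : nat := #|` fset_set (left_cosets V U)|.

Definition normalizer_in H U : set G := [set h | H h /\ conj_set h U = U].

(* [(H / V)^U] *)
Definition fixed_cosets H V U : set (set G) :=
  [set left_coset h V | h in [set h | H h /\ conj_set h^-1 U `<=` V]].

End Groups.

Section Profinite.
Variable G : profiniteGroupType.
Implicit Types (H U V : set G).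

Record truncation_set H (S : set (set G)) : Prop := TruncationSet {
  trunc_sub : forall U, S U -> [/\ subgroup U, open U & U `<=` H];
  trunc_conj : forall h U, H h -> S U -> S (conj_set h U);
  trunc_up : forall U V, S U -> [/\ subgroup V, open V & V `<=` H] ->
    U `<=` V -> S V }.

(* [S0] represents the [H]-conjugacy classes in [S] *)
Definition conj_representatives H (S S0 : set (set G)) : Prop :=
  S0 `<=` S /\ forall U, S U ->
    exists! V, S0 V /\ exists2 h, H h & V = conj_set h U.

Lemma subgroup_gen (A : set G) : subgroup (gen_subgroup A).
Proof.
split; first by apply/mem_set => V Vg _; exact: set_mem Vg.1.
move=> x y /set_mem xA /set_mem yA; apply/mem_set => V Vg AV.
by apply/set_mem/Vg.2; apply/mem_set; [exact: xA | exact: yA].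
Qed.

Lemma subgroupM V x y : subgroup V -> V x -> V y -> V (x * y).
Proof.
by move=> /group_closedM VM xV yV; apply/set_mem/VM; apply/mem_set.
Qed.

Lemma subgroupV V x : subgroup V -> V x -> V x^-1.
Proof. by move=> /group_closedV VV xV; apply/set_mem/VV; apply/mem_set. Qed.

Lemma mulg_continuousr (g : G) : continuous (fun x : G => g * x).
Proof.
move=> x; apply: (@continuous2_cvg _ _ _ _ _ _ (cst g) id).
- exact: (mulg_continuous (g, x)).
- exact: cvg_cst.
- exact: cvg_id.
Qed.

Lemma subgroup_open U V : subgroup V -> open U -> U 1 -> U `<=` V -> open V.
Proof.
move=> Vg oU U1 UV.
have -> : V = \bigcup_(v in V) ((fun x : G => v^-1 * x) @^-1` U).
  apply/seteqP; split=> x.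
    by move=> Vx; exists x => //=; rewrite mulVg.
  move=> [v Vv] /= /UV Vx; have := subgroupM Vg Vv Vx.
  by rewrite mulgA mulgV mul1g.
apply: bigcup_open => v _; apply: open_comp => // x _.
exact: mulg_continuousr.
Qed.

(* [<vU>] belongs to [S] when [U] does and [v] normalises [U] *)
Lemma gen_coset_trunc H S U c : subgroup H -> truncation_set H S -> S U ->
  left_cosets (normalizer_in H U) U c -> S (gen_subgroup c).
Proof.
move=> Hg tS SU [v [Hv _] <-]; have [Ug oU UH] := trunc_sub tS SU.
have U1 : U 1 by apply: set_mem Ug.1.
have UV : U `<=` gen_subgroup (left_coset v U).
  move=> u Uu; have gv w : U w -> gen_subgroup (left_coset v U) (v * w).
    by move=> Uw K _; apply; exists w.
  rewrite -[u]mul1g -(mulVg v) -mulgA; have gg := subgroup_gen (left_coset v U).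
  apply: (subgroupM gg (subgroupV gg _) (gv _ Uu)).
  by have := gv _ U1; rewrite mulg1.
apply: (trunc_up tS SU) => //; split; first exact: subgroup_gen.
- exact: subgroup_open (subgroup_gen _) oU U1 UV.
- move=> x; apply => // _ [u Uu <-]; exact: subgroupM Hv (UH _ Uu).
Qed.

End Profinite.

Section Dwork.
Variables (G : profiniteGroupType) (X Y : choiceType).
Local Notation T := (freeCRing X).
Local Notation Q := {malg T[Y]}.
Implicit Types (H U V : set G).

(* [Q^{\otimes_T G/V}] *)
Definition QG (V : set G) := tpow Q (left_cosets [set: G] V).

(* The isomorphism [g . (-)]: here [V'] stands for [g V g^-1]; it is a separate
   argument since, e.g., [h (h^-1 U h) h^-1] and [U] are not convertible. *)
Definition tensor_act (g : G) (V V' : set G) : QG V -> QG V' :=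
  tpow_reindex (fun a : left_cosets [set: G] V' =>
    mk_coset (coset_rep (set_val a) * g) V).

Definition transfer H U (x : QG U) : QG U :=
  (\sum_(c \in left_cosets (normalizer_in H U) U)
     tensor_act (coset_rep c) U x)%R.

(* the bijection [(g_i V, s U) |-> g_i s U], where [rep] gives the [g_i] *)
Definition coset_prod V U (rep : left_cosets [set: G] V -> G)
    (p : left_cosets [set: G] V * left_cosets V U) : left_cosets [set: G] U :=
  mk_coset (rep p.1 * coset_rep (set_val p.2)) U.

(* [f_{G/V}] goes along [coset_prod], while [tpow_reindex] goes against its
   argument, whence the inverse *)
Definition fGV V U (rep : left_cosets [set: G] V -> G) :
    tpow Q (left_cosets [set: G] V * left_cosets V U)%type -> QG U :=
  inv_iso (tpow_reindex (coset_prod rep)).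

Section Ghost.
Variables (H : set G) (S S0 : set (set G)).
Variable rep : forall V : S0, left_cosets [set: G] (set_val V) -> G.

Definition ghost (n : forall V : S0, QG (set_val V)) (U : S) : QG (set_val U) :=
  (\sum_(V \in [set: S0])
    \sum_(c \in fixed_cosets H (set_val V) (set_val U))
      let h := coset_rep c in
      tensor_act h (set_val U)
        (fGV (@rep V)
          (tens_power (left_cosets (set_val V) (conj_set h^-1 (set_val U)))
             (n V))))%R.

(* the fixed points of [H] on the product of the [QG U], [U] in [S] *)
Definition ghost_group : set (forall U : S, QG (set_val U)) :=
  [set a | forall (h : G) (U U' : S), H h ->
    set_val U' = conj_set h (set_val U) ->
    tensor_act h (set_val U') (a U) = a U'].

End Ghost.

(* [phi_U^V], for [U <= V]; the factor at [gU] is indexed by [gV] *)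
Definition frob_lift (V U : set G) (x : QG V) : QG U :=
  let p := inv_iso (@tpow_basis X Y (left_cosets [set: G] V)) x in
  (\sum_(y <- msupp p) frob (coset_index V U) p@_y *:
     tens (fun c : left_cosets [set: G] U =>
             << y (mk_coset (coset_rep (set_val c)) V) >> : Q))%R.

Definition frob_sum H S (Hg : subgroup H) (tS : truncation_set H S)
    (a : forall U : S, QG (set_val U)) (U : S) : QG (set_val U) :=
  (\sum_(c \in [set: left_cosets (normalizer_in H (set_val U)) (set_val U)])
     frob_lift (set_val U)
       (a (SigSub (mem_set
          (gen_coset_trunc Hg tS (set_valP U) (set_valP c))))))%R.

End Dwork.

(* Main.v *)
(* Write M_U for the tensor power of Q indexed by G/U. It is free over Z on the
   pairs of a monomial of T and a function G/U -> Y, and N_H(U) permutes this basis.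

   (i) => (ii). Fix V and suppose that n_V is a sum of basis elements b_i, i in I,
   repetitions being allowed. Expanding the tensor powers, phi_U^K applied to the
   V-summand of w_K(n) becomes the sum over the K-invariant elements e of one
   finite N_H(U)-set E of basis elements beta(e) of M_U, where beta is equivariant:
   phi_U^K raises a monomial to the power |K : U|, which compensates for the number
   of U-cosets in a K-coset. Elements of E are families V/h^-1Uh -> I with
   hV in (H/V)^U. The sum over vU of phi_U^<vU>(w_<vU>(n)) is thus the sum over v of
   beta over the fixed points of v, that is the sum over E of
   |stabiliser of e| beta(e), which is the transfer of the sum of beta over orbit
   representatives. If n_V has negative coefficients, it is congruent modulo
   N = |N_H(U)/U| to an n_V' with nonnegative ones. The two Frobenius sums then differ
   by N y; they are invariant, so y is invariant and N y is the transfer of y.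

   (ii) => (i). Construct n by induction on the index |G : U|. If w(n) and a agree
   on the larger subgroups, the Frobenius sum of a - w(n) at U reduces to
   a_U - w_U(n), and since (ii) holds for both a and w(n) it is a transfer tr(x).
   Setting n_U = x for the chosen representative U corrects w_U(n) by tr(x). *)

From HB Require Import structures.
Require Import Defs.
From mathcomp Require Import all_boot all_algebra finmap.
From mathcomp Require Import multinomials.monalg.
From mathcomp Require Import boolp classical_sets functions cardinality fsbigop.
From mathcomp Require Import topology.

Set Implicit Arguments.
Unset Strict Implicit.
Unset Printing Implicit Defensive.

Import GRing.Theory.

Local Open Scope classical_set_scope.
Local Open Scope group_scope.

(** * Dual bases of tensor powers *)

Section DualBases.
Local Open Scope ring_scope.

Lemma linear_morph0 (T : pzRingType) (M N : lmodType T) (f : M -> N) :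
  linear f -> f 0 = 0.
Proof. by move=> lf; have := lf (-1) 0 0; rewrite scaler0 addr0 scaleN1r addNr. Qed.

Lemma linear_morphD (T : pzRingType) (M N : lmodType T) (f : M -> N) :
  linear f -> {morph f : x y / x + y}.
Proof. by move=> lf x y; have := lf 1 x y; rewrite !scale1r. Qed.

Lemma linear_morphZ (T : pzRingType) (M N : lmodType T) (f : M -> N) r x :
  linear f -> f (r *: x) = r *: f x.
Proof. by move=> lf; rewrite -[r *: x]addr0 lf linear_morph0// addr0. Qed.

Lemma linear_morph_sum (T : pzRingType) (M N : lmodType T) (f : M -> N) I
    (s : seq I) (P : pred I) (F : I -> M) :
  linear f -> f (\sum_(i <- s | P i) F i) = \sum_(i <- s | P i) f (F i).
Proof.
by move=> lf; apply: big_morph; [exact: linear_morphD | exact: linear_morph0].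
Qed.

Section DualBasis.
Variables (T : comNzRingType) (M : lmodType T) (J : choiceType).
Variables (g : J -> M) (l : J -> M -> T).

(** A basis together with its coordinate functionals: duality gives independence, and the last
    clause says that finite combinations span. Vectors can then be compared on coordinates, and
    linear maps on basis vectors. *)
Definition dual_basis : Prop :=
  [/\ forall j, linear (l j : M -> T^o),
      forall i j, l i (g j) = (i == j)%:R
    & forall x, exists s : seq (T * J), x = \sum_(p <- s) p.1 *: g p.2].

Hypothesis gl : dual_basis.

(** Applying [l j] to any finite expression of [x] gives the sum of all coefficients attached to
    [j], so grouping equal indices yields the coordinates. *)
Lemma dual_basis_expand x : exists s : seq J,
  uniq s /\ x = \sum_(j <- s) l j x *: g j.
Proof.
have [ll lg sp] := gl; have [s xs] := sp x.
exists (undup [seq p.2 | p <- s]); split; first exact: undup_uniq.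
have lx j : l j x = \sum_(p <- s | p.2 == j) p.1.
  rewrite {1}xs (linear_morph_sum _ _ _ (ll j)) [RHS]big_mkcond /=.
  apply: eq_bigr => p _; rewrite (linear_morphZ _ _ (ll j)) lg eq_sym.
  by case: eqP => _; rewrite /GRing.scale /= ?mulr1 ?mulr0.
transitivity (\sum_(j <- undup [seq p.2 | p <- s])
    \sum_(p <- s | p.2 == j) p.1 *: g j); last first.
  by apply: eq_bigr => j _; rewrite lx scaler_suml.
rewrite (exchange_big_dep xpredT) //= {1}xs big_seq [RHS]big_seq.
apply: eq_bigr => p ps; have ip : p.2 \in undup [seq p.2 | p <- s].
  by rewrite mem_undup map_f.
rewrite big_mkcond (bigD1_seq p.2) //= ?undup_uniq//.
by rewrite eqxx big1 ?addr0// => j; rewrite eq_sym => /negbTE ->.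
Qed.

Lemma dual_basis_inj x y : (forall j, l j x = l j y) -> x = y.
Proof.
move=> h; apply/subr0_eq; have [s [_ ->]] := dual_basis_expand (x - y).
have [ll _ _] := gl.
apply: big1 => j _; rewrite (linear_morphD (ll j)) -scaleN1r.
by rewrite (linear_morphZ _ _ (ll j)) h scaleN1r subrr scale0r.
Qed.

Lemma dual_basis_ext (N : lmodType T) (f f' : M -> N) :
  linear f -> linear f' -> (forall j, f (g j) = f' (g j)) -> f =1 f'.
Proof.
move=> lf lf' e x; have [_ _ sp] := gl; have [s ->] := sp x.
rewrite !linear_morph_sum//; apply: eq_bigr => p _.
by rewrite !linear_morphZ// e.
Qed.

End DualBasis.

(** * The dual basis of a finite tensor power *)

Section TensorDual.
Variables (T : comNzRingType) (M : lmodType T) (J : choiceType).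
Variables (g : J -> M) (l : J -> M -> T) (gl : dual_basis g l).
Variables (Z : choiceType) (s : seq Z) (us : uniq s) (sP : forall z, z \in s).

Definition tens_coef (p : Z -> J) : tpow M Z -> T :=
  tlift (fun m : Z -> M => \prod_(z <- s) l (p z) (m z) : T^o).

(** Each index occurs exactly once in [s], so changing one factor of the tensor changes exactly one
    factor of the product, and linearly. *)
Lemma tens_coef_multilinear (p : Z -> J) :
  multilinear (fun m : Z -> M => \prod_(z <- s) l (p z) (m z) : T^o).
Proof.
have [ll _ _] := gl; move=> m z r u v.
have E w : \prod_(z0 <- s) l (p z0) (upd m z w z0) =
    l (p z) w * \prod_(z0 <- s | z0 != z) l (p z0) (m z0).
  rewrite (bigD1_seq z) //= {1}/upd eqxx; congr (_ * _).
  by apply: eq_bigr => z0 /negbTE h; rewrite /upd h.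
by rewrite !E (ll (p z)) mulrDl /GRing.scale /= mulrA.
Qed.

Lemma tens_coef_linear p : linear (tens_coef p : _ -> T^o).
Proof. exact/tlift_linear/tens_coef_multilinear. Qed.

Lemma tens_coef_tens p m : tens_coef p (tens m) = \prod_(z <- s) l (p z) (m z).
Proof. exact: (tlift_tens m (tens_coef_multilinear p)). Qed.

Lemma tens_span (m : Z -> M) :
  exists t : seq (T * (Z -> J)), tens m = \sum_(p <- t) p.1 *: tens (g \o p.2).
Proof.
have [_ _ sp] := gl.
(* Generalisation for the induction: [s'] lists the slots whose factor need not be a basis vector
   yet. Each step expands one such slot by multilinearity. *)
suff H (s' : seq Z) : forall m : Z -> M,
    (forall z, z \in s' \/ exists j, m z = g j) ->
    exists t : seq (T * (Z -> J)), tens m = \sum_(p <- t) p.1 *: tens (g \o p.2).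
  by apply: (H s) => z; left.
elim: s' => [|z0 s' ih] {}m hm.
  have /choice[p hp] : forall z, exists j, m z = g j.
    by move=> z; case: (hm z).
  exists [:: (1, p)]; rewrite big_seq1 scale1r; congr tens.
  by apply/funext => z; rewrite hp.
have [t ht] := sp (m z0).
have -> : m = upd m z0 (m z0).
  by apply/funext => z; rewrite /upd; case: eqP => // ->.
rewrite ht; elim: t {ht} => [|[c j] t [u iht]].
  exists [::]; rewrite !big_nil.
  have := tens_multilinear m z0 (-1) 0 0.
  by rewrite scaler0 addr0 scaleN1r addNr.
have [|v hv] := ih (upd m z0 (g j)).
  move=> z; rewrite /upd; case: eqP => [_|zz]; first by right; exists j.
  have [|[j' e]] := hm z; last by right; exists j'.
  by rewrite inE => /orP[/eqP//|]; left.
exists ([seq (c * p.1, p.2) | p <- v] ++ u).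
rewrite big_cons tens_multilinear iht hv /= big_cat big_map /=; congr (_ + _).
by rewrite scaler_sumr; apply: eq_bigr => p _; rewrite scalerA.
Qed.

Lemma tens_dual_basis : dual_basis (fun p : Z -> J => tens (g \o p)) tens_coef.
Proof.
have [ll lg sp] := gl; split; first exact: tens_coef_linear.
  move=> p q; rewrite tens_coef_tens; case: eqP => [->|ne].
    by rewrite big1// => z _; rewrite /= lg eqxx.
  have [z hz] : exists z, p z <> q z.
    by apply: contrapT => h; apply: ne; apply/funext => z;
       apply: contrapT => h'; apply: h; exists z.
  rewrite (bigD1_seq z) //= lg; case: eqP => // _.
  by rewrite mul0r.
move=> x; have [y ->] := tpow_surj x.
pose P x := exists t : seq (T * (Z -> J)),
  x = \sum_(p <- t) p.1 *: tens (g \o p.2).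
suff: P (\pi_(tpow M Z)%qT y) by [].
rewrite [y]monalgE; elim: (enum_fset (msupp y)) => [|m t ih].
  by rewrite big_nil; exists [::]; rewrite big_nil piE.
rewrite big_cons; have -> : << y@_m *g m >> = y@_m *: << m >> :> free_tens M Z.
  by apply/malgP => k; rewrite mcoeffZ !mcoeffU mulrnAr mulr1.
rewrite tpow_pi_linear; case: ih => u ->.
have [v hv] := tens_span m; rewrite -/(tens m) hv.
exists ([seq (y@_m * p.1, p.2) | p <- v] ++ u).
rewrite big_cat big_map /=; congr (_ + _).
by rewrite scaler_sumr; apply: eq_bigr => p _; rewrite scalerA.
Qed.

End TensorDual.

Lemma malg_dual_basis (T : comNzRingType) (Y : choiceType) :
  dual_basis (fun y : Y => << y >> : {malg T[Y]}) (fun y x => x@_y).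
Proof.
split=> [y r u v|y y'|x].
- by rewrite mcoeffD mcoeffZ.
- by rewrite mcoeffU eq_sym.
exists [seq (x@_y, y) | y <- enum_fset (msupp x)].
rewrite big_map {1}[x]monalgE; apply: eq_bigr => y _ /=.
by apply/malgP => k; rewrite mcoeffZ !mcoeffU mulrnAr mulr1.
Qed.

End DualBases.

(** * Cosets *)

Ltac gsimp :=
  rewrite ?(invgM, invgK, mulgA, mulgK, mulgVK, mulVg, mulgV, mul1g, mulg1, invg1).

Section Cosets.
Variable G : profiniteGroupType.
Implicit Types (A H K U V : set G) (g h u z : G).

(** Functions on [G/U] are encoded as right [U]-invariant functions on [G]. For varying [U] they
    then share one type, and pulling back along [G/U -> G/V] becomes an inclusion. *)
Definition right_inv (R : Type) U (f : G -> R) : Prop :=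
  forall z u, U u -> f (z * u) = f z.

Lemma subgroup1 U : subgroup U -> U 1.
Proof. by case=> /set_mem. Qed.

Lemma left_cosetE g U : subgroup U -> left_coset g U = [set z | U (g^-1 * z)].
Proof.
move=> Ug; apply/seteqP; split=> [_ [u Uu <-]|z /= h]; first by rewrite /= mulKg.
by exists (g^-1 * z) => //; rewrite mulVKg.
Qed.

Lemma mem_left_coset g U : subgroup U -> left_coset g U g.
Proof. by move=> Ug; rewrite left_cosetE//= mulVg; exact: subgroup1. Qed.

Lemma left_coset_eq g h U : subgroup U ->
  (left_coset g U = left_coset h U) <-> U (g^-1 * h).
Proof.
move=> Ug; split=> [e|gh].
  by have := mem_left_coset h Ug; rewrite -e left_cosetE.
rewrite !left_cosetE//; apply/seteqP; split=> z /= zU.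
  by have := subgroupM Ug (subgroupV Ug gh) zU; gsimp.
by have := subgroupM Ug gh zU; gsimp.
Qed.

Lemma left_coset_id u U : subgroup U -> U u -> left_coset u U = U.
Proof.
move=> Ug Uu; rewrite left_cosetE//; apply/seteqP; split=> z /= h.
  by have := subgroupM Ug Uu h; gsimp.
by apply: subgroupM => //; exact: subgroupV.
Qed.

Lemma left_cosets_id U : subgroup U -> left_cosets U U = [set U].
Proof.
move=> Ug; apply/seteqP; split=> [_ [u Uu <-]|_ ->]; first exact: left_coset_id.
by exists 1; [|apply: left_coset_id => //]; exact: subgroup1.
Qed.

Lemma coset_repP g U : subgroup U -> left_coset g U (coset_rep (left_coset g U)).
Proof. by move=> Ug; apply: xgetPex; exists g; exact: mem_left_coset. Qed.

Lemma coset_rep_mul g U : subgroup U ->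
  exists2 u, U u & coset_rep (left_coset g U) = g * u.
Proof. by move=> Ug; have [u Uu <-] := coset_repP g Ug; exists u. Qed.

Lemma right_inv_rep (R : Type) U (f : G -> R) g : subgroup U -> right_inv U f ->
  f (coset_rep (left_coset g U)) = f g.
Proof. by move=> Ug fU; have [u Uu ->] := coset_rep_mul g Ug; rewrite fU. Qed.

Lemma right_invW (R : Type) U V (f : G -> R) : U `<=` V ->
  right_inv V f -> right_inv U f.
Proof. by move=> UV fV z u /UV; exact: fV. Qed.

Lemma left_coset_rep A U c : subgroup U -> left_cosets A U c ->
  left_coset (coset_rep c) U = c.
Proof.
move=> Ug [g _ <-]; apply/left_coset_eq => //.
have [u Uu ->] := coset_rep_mul g Ug; gsimp.
exact: subgroupV.
Qed.

Lemma mk_coset_eq g h U : subgroup U -> U (g^-1 * h) -> mk_coset g U = mk_coset h U.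
Proof. by move=> Ug gh; apply: val_inj => /=; apply/left_coset_eq. Qed.

Lemma mk_coset_inj g h U : subgroup U -> mk_coset g U = mk_coset h U -> U (g^-1 * h).
Proof. by move=> Ug /(congr1 val) /= /left_coset_eq; apply. Qed.

Lemma mk_coset_rep U (d : left_cosets [set: G] U) : subgroup U ->
  mk_coset (coset_rep (set_val d)) U = d.
Proof.
by move=> Ug; apply: val_inj; rewrite /= (left_coset_rep Ug (set_valP d)).
Qed.

Lemma right_inv_mk_coset (R : Type) U (f : left_cosets [set: G] U -> R) :
  subgroup U -> right_inv U (fun z => f (mk_coset z U)).
Proof.
move=> Ug z u Uu; congr f; apply: mk_coset_eq => //; gsimp.
exact: subgroupV.
Qed.

Lemma conj_setE g U : subgroup U -> conj_set g U = [set z | U (g^-1 * z * g)].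
Proof.
move=> Ug; apply/seteqP; split=> [_ [u Uu <-]|z /= h]; first by rewrite /=; gsimp.
by exists (g^-1 * z * g) => //; gsimp.
Qed.

Lemma conj_set_subgroup g U : subgroup U -> subgroup (conj_set g U).
Proof.
move=> Ug; rewrite conj_setE//; split.
  by apply/mem_set; rewrite /= mulg1 mulVg; exact: subgroup1.
move=> x y /set_mem /= xU /set_mem /= yU; apply/mem_set => /=.
by have := subgroupM Ug xU (subgroupV Ug yU); gsimp.
Qed.

Lemma conj_setM g h U : conj_set g (conj_set h U) = conj_set (g * h) U.
Proof.
apply/seteqP; split=> [_ [_ [u Uu <-] <-]|_ [u Uu <-]].
  by exists u => //; gsimp.
by exists (h * u * h^-1); [exists u|gsimp].
Qed.

Lemma conj_set1 U : conj_set 1 U = U.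
Proof.
apply/seteqP; split=> [_ [u Uu <-]|u Uu]; first by gsimp.
by exists u => //; gsimp.
Qed.

Lemma conj_setS g U V : U `<=` V -> conj_set g U `<=` conj_set g V.
Proof. by move=> UV _ [u /UV Vu <-]; exists u. Qed.

Lemma conj_set_id g U : subgroup U -> U g -> conj_set g U = U.
Proof.
move=> Ug gU; rewrite conj_setE//; apply/seteqP; split=> z /= zU.
  have := subgroupM Ug (subgroupM Ug gU zU) (subgroupV Ug gU); gsimp; exact.
by apply: subgroupM => //; apply: subgroupM => //; exact: subgroupV.
Qed.

Lemma normalizer_subgroup H U : subgroup H -> subgroup (normalizer_in H U).
Proof.
move=> Hg; split; first by apply/mem_set; split; [exact: subgroup1|exact: conj_set1].
move=> x y /set_mem [Hx xU] /set_mem [Hy yU]; apply/mem_set; split.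
  by apply: subgroupM => //; exact: subgroupV.
rewrite -conj_setM; suff -> : conj_set y^-1 U = U by [].
by rewrite -{1}yU conj_setM mulVg conj_set1.
Qed.

Lemma normalizer_conj H U v u : normalizer_in H U v -> U u -> U (v^-1 * u * v).
Proof.
move=> [_ e]; rewrite -{1}e => -[u' U' <-]; gsimp.
exact: U'.
Qed.

Lemma normalizer_conjV H U v u : normalizer_in H U v -> U u -> U (v * u * v^-1).
Proof. by move=> [_ e] Uu; rewrite -e; exists u. Qed.

Lemma normalizer_sub H U : subgroup U -> U `<=` H -> U `<=` normalizer_in H U.
Proof. by move=> Ug UH u Uu; split; [exact: UH|exact: conj_set_id]. Qed.

(** The cosets of an open subgroup form an open cover of the compact group [G], and a finite
    subcover contains every coset. *)
Lemma finite_left_cosets V : subgroup V -> open V ->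
  finite_set (left_cosets [set: G] V).
Proof.
(* The equivalence of compactness with the covering property is stated for pointed spaces, so [1] is
   taken as base point. *)
move=> Vg oV; pose pG := classical_sets.isPointed.Build G (1 : G).
pose Gp : ptopologicalType := HB.pack G pG.
have : cover_compact [set: G].
  by rewrite -(@compact_cover Gp); exact: (@profinite_compact G).
have co g : open (left_coset g V).
  rewrite left_cosetE//; apply: (@open_comp _ _ (fun z => g^-1 * z) V) => //.
  by move=> x _; exact: mulg_continuousr.
move=> /(_ G [set: G] (fun g => left_coset g V)) [].
- by move=> g _; exact: co.
- by move=> g _; exists g => //; exact: mem_left_coset.
move=> D' _ DG; apply: (@sub_finite_set _ _ ((fun g => left_coset g V) @` [set` D'])).
  move=> _ [g _ <-]; have [h hD hg] := DG g I.
  by exists h => //; apply/left_coset_eq => //; rewrite left_cosetE in hg.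
exact: finite_image.
Qed.

Lemma finite_left_cosetsS A V :
  finite_set (left_cosets [set: G] V) -> finite_set (left_cosets A V).
Proof. by apply: sub_finite_set => _ [g _ <-]; exists g. Qed.

Section Reindex.
Variables (R : Type) (idx : R) (op : Monoid.com_law idx).

(** The conditions on [phi] make it induce a bijection from [A/U] to [A'/U'], and invariance of [f]
    removes the dependence on representatives. It serves for translations and conjugations. *)
Lemma big_coset_reindex A A' U U' (phi : G -> G) (f : G -> R) :
  subgroup U -> subgroup U' -> right_inv U' f ->
  (forall a, A a -> A' (phi a)) ->
  (forall a b, U (a^-1 * b) <-> U' ((phi a)^-1 * phi b)) ->
  (forall a', A' a' -> exists2 a, A a & U' (a'^-1 * phi a)) ->
  (forall a u, A a -> U u -> A (a * u)) ->
  \big[op/idx]_(c \in left_cosets A' U') f (coset_rep c) =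
  \big[op/idx]_(c \in left_cosets A U) f (phi (coset_rep c)).
Proof.
move=> Ug U'g fU AA phiU phiS AU.
pose h c := left_coset (phi (coset_rep c)) U'.
have hE g : h (left_coset g U) = left_coset (phi g) U'.
  by apply/left_coset_eq => //; apply/phiU/left_coset_eq => //;
     rewrite (left_coset_rep (A := [set: G]))//; exists g.
rewrite (reindex_fsbig h (left_cosets A U)).
  by apply: eq_fsbigr => c _; rewrite right_inv_rep.
split.
- by move=> _ [a Aa <-]; rewrite hE; exists (phi a) => //; exact: AA.
- move=> _ _ /set_mem [a Aa <-] /set_mem [b Ab <-]; rewrite !hE.
  by move/left_coset_eq => /(_ U'g) /phiU ab; apply/left_coset_eq.
- move=> _ [a' Aa' <-]; have [a Aa aa] := phiS a' Aa'.
  exists (left_coset a U); first by exists a.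
  by rewrite hE; apply/left_coset_eq => //; have := subgroupV U'g aa; gsimp.
Qed.

Lemma big_set_type (I : choiceType) (A : set I) (F : I -> R) :
  \big[op/idx]_(d \in [set: A]) F (set_val d) = \big[op/idx]_(c \in A) F c.
Proof. by rewrite [RHS](reindex_fsbig (fun d : A => set_val d) setT). Qed.

End Reindex.

End Cosets.

(** * Coordinates of the operations on tensor powers *)

Lemma inv_isoK (A B : nmodType) (f : A -> B) : injective f ->
  cancel f (inv_iso f).
Proof. by move=> fi x; apply: xget_unique => // y /fi. Qed.

Lemma finite_set_type (I : choiceType) (A : set I) :
  finite_set A -> finite_set [set: A].
Proof. by rewrite (eq_finite_set (card_setT A)). Qed.

Section Coef.
Variables (T : comNzRingType) (Y : choiceType).
Local Notation Q := {malg T[Y]}.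
Local Open Scope ring_scope.

(* Junk unless [Z] is finite. *)
Definition ycoef (Z : choiceType) (p : Z -> Y) : tpow Q Z -> T :=
  tens_coef (fun y (x : Q) => x@_y) (fset_set [set: Z]) p.

Lemma ycoef_dual_basis (Z : choiceType) : finite_set [set: Z] ->
  dual_basis (fun p : Z -> Y => tens (fun z => << p z >> : Q)) (@ycoef Z).
Proof.
move=> fZ; apply: (tens_dual_basis (malg_dual_basis T Y) (fset_uniq _)) => z.
by rewrite in_fset_set ?inE.
Qed.

Section Reindex.
Variables (Z Z' : choiceType) (e : Z' -> Z) (e' : Z -> Z').
Hypotheses (eK : cancel e e') (e'K : cancel e' e).

Lemma tpow_reindex_multilinear :
  multilinear (fun m : Z -> Q => tens (m \o e) : tpow Q Z').
Proof.
move=> m z r u v; have E w : upd m z w \o e = upd (m \o e) (e' z) w.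
  by apply/funext => z'; rewrite /upd /= (can2_eq eK e'K).
by rewrite !E tens_multilinear.
Qed.

Lemma tpow_reindex_linear : linear (tpow_reindex e : tpow Q Z -> tpow Q Z').
Proof. exact: tlift_linear tpow_reindex_multilinear. Qed.

Lemma tpow_reindex_tens (m : Z -> Q) : tpow_reindex e (tens m) = tens (m \o e).
Proof. exact: tlift_tens tpow_reindex_multilinear. Qed.

(** By linearity it is enough to test a basis tensor [q], where the claim is that [p = q \o e]
    exactly when [p \o e' = q]. *)
Lemma ycoef_reindex (p : Z' -> Y) x :
  finite_set [set: Z] -> finite_set [set: Z'] ->
  ycoef p (tpow_reindex e x) = ycoef (p \o e') x.
Proof.
move=> fZ fZ'; have [lZ dZ _] := ycoef_dual_basis fZ.
have [lZ' dZ' _] := ycoef_dual_basis fZ'.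
pose f x : T^o := ycoef p (tpow_reindex e x).
apply: (dual_basis_ext (ycoef_dual_basis fZ) (f := f)).
- by move=> r u v; rewrite /f tpow_reindex_linear lZ'.
- exact: lZ.
move=> q; rewrite /f tpow_reindex_tens (dZ' p (q \o e)) dZ; congr ((nat_of_bool _)%:R).
by apply/eqP/eqP => [->|<-]; apply/funext => z /=; rewrite ?e'K ?eK.
Qed.

End Reindex.

Section Curry.
Variables (A B : choiceType) (fA : finite_set [set: A]) (fB : finite_set [set: B]).

Lemma tpow_curry_multilinear : multilinear
  (fun m : A * B -> Q => tens (fun b => tens (fun a => m (a, b))) :
     tpow (tpow Q A) B).
Proof.
move=> m [a0 b0] r u v.
have E w : (fun b => tens (fun a => upd m (a0, b0) w (a, b)) : tpow Q A) =
    upd (fun b => tens (fun a => m (a, b))) b0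
      (tens (upd (fun a => m (a, b0)) a0 w)).
  apply/funext => b; rewrite /upd; case: eqP => [->|ne]; congr tens.
    by apply/funext => a; rewrite xpair_eqE eqxx andbT.
  by apply/funext => a; rewrite xpair_eqE; case: eqP => //=; case: eqP.
by rewrite !E tens_multilinear tens_multilinear.
Qed.

Lemma tpow_curry_linear :
  linear (@tpow_curry T Q A B : tpow Q (A * B)%type -> tpow (tpow Q A) B).
Proof. exact: tlift_linear tpow_curry_multilinear. Qed.

Definition ycoef2 (p : B -> A -> Y) : tpow (tpow Q A) B -> T :=
  tens_coef (@ycoef A) (fset_set [set: B]) p.

Lemma ycoef2_dual_basis : dual_basis
  (fun p : B -> A -> Y => tens (fun b => tens (fun a => << p b a >> : Q)))
  ycoef2.
Proof.
apply: (tens_dual_basis (ycoef_dual_basis fA) (fset_uniq _)) => z.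
by rewrite in_fset_set ?inE.
Qed.

Lemma finite_set_pair : finite_set [set: A * B].
Proof. by rewrite -setXTT; exact: finite_setX. Qed.

Lemma ycoef_curry p (x : tpow Q (A * B)%type) :
  ycoef2 p (tpow_curry x) = ycoef (fun ab => p ab.2 ab.1) x.
Proof.
have [l1 d1 _] := ycoef_dual_basis finite_set_pair.
have [l2 d2 _] := ycoef2_dual_basis.
pose f x : T^o := ycoef2 p (@tpow_curry T Q A B x).
apply: (dual_basis_ext (ycoef_dual_basis finite_set_pair) (f := f)).
- by move=> r u v; rewrite /f tpow_curry_linear l2.
- exact: l1.
move=> q; rewrite /f /tpow_curry tlift_tens; last exact: tpow_curry_multilinear.
rewrite (d2 p (fun b a => q (a, b))) d1; congr ((nat_of_bool _)%:R).
apply/eqP/eqP => [->|<-]; first by apply/funext => -[].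
by apply/funext => b; apply/funext.
Qed.

(** With surjectivity below, this guarantees that [inv_iso] in [tens_power] returns a genuine
    inverse image and not its default value. *)
Lemma tpow_curry_inj : injective (@tpow_curry T Q A B).
Proof.
move=> x y e; apply: (dual_basis_inj (ycoef_dual_basis finite_set_pair)) => p.
have := congr1 (ycoef2 (fun b a => p (a, b))) e; rewrite !ycoef_curry.
by have -> : (fun ab => p (ab.1, ab.2)) = p by apply/funext => -[].
Qed.

Lemma tpow_curry_surj v : exists x, @tpow_curry T Q A B x = v.
Proof.
have [_ _ sp] := ycoef2_dual_basis; have [s ->] := sp v.
exists (\sum_(p <- s) p.1 *: tens (fun ab => << p.2 ab.2 ab.1 >> : Q)).
rewrite (linear_morph_sum _ _ _ tpow_curry_linear); apply: eq_bigr => p _.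
rewrite (linear_morphZ _ _ tpow_curry_linear) /tpow_curry tlift_tens//.
exact: tpow_curry_multilinear.
Qed.

(** Currying matches coordinates, and the curried element is the pure tensor with constant factor
    [n], whose coordinates are products. *)
Lemma ycoef_tens_power (n : tpow Q A) (p : A * B -> Y) :
  ycoef p (tens_power B n) = \prod_(b <- fset_set [set: B]) ycoef (fun a => p (a, b)) n.
Proof.
have [x xE] := tpow_curry_surj (tens (fun _ : B => n)).
rewrite /tens_power -xE inv_isoK; last exact: tpow_curry_inj.
transitivity (ycoef2 (fun b a => p (a, b)) (tpow_curry x)).
  by rewrite ycoef_curry; congr (ycoef _ x); apply/funext => -[].
rewrite xE /ycoef2 (tens_coef_tens (ycoef_dual_basis fA) (fset_uniq _))//.
by move=> z; rewrite in_fset_set ?inE.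
Qed.

End Curry.
End Coef.

Section Basis.
Variables (X Y : choiceType).
Local Notation T := (freeCRing X).
Local Notation Q := {malg T[Y]}.
Local Open Scope ring_scope.
Variables (Z : choiceType) (fZ : finite_set [set: Z]).

Lemma ycoef_tpow_basis (p : Z -> Y) (q : {malg T[Z -> Y]}) :
  ycoef p (tpow_basis q) = q@_p.
Proof.
have [l d _] := ycoef_dual_basis T Y fZ.
rewrite /tpow_basis (linear_morph_sum _ _ _ (l p)).
rewrite [RHS](congr1 (mcoeff p) (monalgE q)) raddf_sum /=.
apply: eq_bigr => y _.
by rewrite (linear_morphZ _ _ (l p)) d mcoeffU /GRing.scale /= mulr_natr eq_sym.
Qed.

Lemma tpow_basis_inj : injective (@tpow_basis X Y Z).
Proof. by move=> p q e; apply/malgP => y; rewrite -!ycoef_tpow_basis e. Qed.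

Lemma inv_tpow_basisE (x : tpow Q Z) (p : Z -> Y) :
  (inv_iso (@tpow_basis X Y Z) x)@_p = ycoef p x.
Proof.
have [l d _] := ycoef_dual_basis T Y fZ.
have [s [us xs]] := dual_basis_expand (ycoef_dual_basis T Y fZ) x.
(* The preimage of [x] is assembled from its coordinates; injectivity then identifies it with the
   value of [inv_iso]. *)
pose q : {malg T[Z -> Y]} := \sum_(y <- s) << ycoef y x *g y >>.
suff xq : x = tpow_basis q.
  have K := inv_isoK tpow_basis_inj q.
  by rewrite xq K ycoef_tpow_basis.
apply: (dual_basis_inj (ycoef_dual_basis T Y fZ)) => p'.
rewrite ycoef_tpow_basis {1}xs (linear_morph_sum _ _ _ (l p')) /q raddf_sum /=.
apply: eq_bigr => y _.
by rewrite (linear_morphZ _ _ (l p')) d mcoeffU /GRing.scale /= mulr_natr eq_sym.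
Qed.

End Basis.

(** * Coordinates indexed by invariant functions on the group *)

Section GroupCoef.
Variables (G : profiniteGroupType) (X Y : choiceType).
Local Notation T := (freeCRing X).
Local Notation Q := {malg T[Y]}.
Local Notation QG := (QG X Y).
Implicit Types (H U V : set G) (eta : G -> Y).

(** The algebraic consequence of openness on which the coordinate computations rest. *)
Definition fin_subgroup U := subgroup U /\ finite_set (left_cosets [set: G] U).

(** The index is a function on [G] read at chosen representatives; for right [U]-invariant [eta] the
    choice is immaterial. *)
Definition coef U eta (x : QG U) : T :=
  ycoef (fun d : left_cosets [set: G] U => eta (coset_rep (set_val d))) x.

Definition gtens U eta : QG U :=
  tens (fun d : left_cosets [set: G] U => << eta (coset_rep (set_val d)) >>%R : Q).

Lemma fin_cosets U : fin_subgroup U -> finite_set [set: left_cosets [set: G] U].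
Proof. by case=> _; exact: finite_set_type. Qed.

Lemma right_inv_cosets U (p : left_cosets [set: G] U -> Y) : subgroup U ->
  (fun d : left_cosets [set: G] U => p (mk_coset (coset_rep (set_val d)) U)) = p.
Proof. by move=> Ug; apply/funext => d; rewrite mk_coset_rep. Qed.

Lemma coef_linear U eta : fin_subgroup U -> linear (coef (U := U) eta : _ -> T^o).
Proof. by move=> fU; have [l _ _] := ycoef_dual_basis T Y (fin_cosets fU); exact: l. Qed.

Lemma coef_inj U (x y : QG U) : fin_subgroup U ->
  (forall eta, right_inv U eta -> coef eta x = coef eta y) -> x = y.
Proof.
move=> fU h; apply: (dual_basis_inj (ycoef_dual_basis T Y (fin_cosets fU))) => p.
have Ug := fU.1; rewrite -(right_inv_cosets p Ug).
exact: (h (fun z => p (mk_coset z U)) (right_inv_mk_coset _ Ug)).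
Qed.

Lemma coef_gtens U eta eta' : fin_subgroup U -> right_inv U eta -> right_inv U eta' ->
  coef eta (gtens U eta') = (eta == eta')%:R%R.
Proof.
move=> fU eU eU'; have [_ d _] := ycoef_dual_basis T Y (fin_cosets fU).
rewrite /coef (d _ (fun d => eta' (coset_rep (set_val d)))).
congr ((nat_of_bool _)%:R)%R; apply/eqP/eqP => [e|->//].
apply/funext => z; have := congr1 (fun f => f (mk_coset z U)) e.
by rewrite /= !right_inv_rep//; exact: fU.1.
Qed.

Lemma gtens_expand U (x : QG U) : fin_subgroup U ->
  exists s : seq (G -> Y), [/\ uniq s, forall eta, eta \in s -> right_inv U eta
    & x = (\sum_(eta <- s) coef eta x *: gtens U eta)%R].
Proof.
move=> fU; have Ug := fU.1.
have [s [us xs]] := dual_basis_expand (ycoef_dual_basis T Y (fin_cosets fU)) x.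
exists [seq (fun z => p (mk_coset z U)) | p <- s]; split.
- rewrite map_inj_uniq// => p q e; rewrite -(right_inv_cosets p Ug).
  rewrite -(right_inv_cosets q Ug); apply/funext => d.
  exact: (congr1 (fun f => f (coset_rep (set_val d))) e).
- by move=> _ /mapP[p _ ->]; exact: right_inv_mk_coset.
rewrite big_map {1}xs; apply: eq_bigr => p _.
have e := esym (right_inv_cosets p Ug).
rewrite /coef /gtens -(congr1 (fun q => ycoef q x) e).
by rewrite -(congr1 (fun q : _ -> Y => tens (fun z => << q z >>%R : Q)) e).
Qed.

Section Act.
Variables (g : G) (V V' : set G).
Hypotheses (fV : fin_subgroup V) (fV' : fin_subgroup V') (V'E : V' = conj_set g V).

Let e (a : left_cosets [set: G] V') := mk_coset (coset_rep (set_val a) * g) V.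
Let e' (a : left_cosets [set: G] V) := mk_coset (coset_rep (set_val a) * g^-1) V'.

Let Vg := fV.1.
Let Vg' := fV'.1.

Let conjV' v : V v -> V' (g * v * g^-1).
Proof. by move=> Vv; rewrite V'E; exists v. Qed.

Let conjV v : V' v -> V (g^-1 * v * g).
Proof. by rewrite V'E conj_setE. Qed.

(** Another representative changes [z] by an element of [V'] on the right, and conjugation by [g^-1]
    carries [V'] to [V]. *)
Let eE z : e (mk_coset z V') = mk_coset (z * g) V.
Proof.
apply: mk_coset_eq => //=; have [u Uu ->] := coset_rep_mul z Vg'; gsimp.
by have := conjV (subgroupV Vg' Uu).
Qed.

Let e'E z : e' (mk_coset z V) = mk_coset (z * g^-1) V'.
Proof.
apply: mk_coset_eq => //=; have [u Uu ->] := coset_rep_mul z Vg; gsimp.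
by have := conjV' (subgroupV Vg Uu).
Qed.

Let eK : cancel e e'.
Proof. by move=> a; rewrite -(mk_coset_rep a Vg') eE e'E; gsimp. Qed.

Let e'K : cancel e' e.
Proof. by move=> a; rewrite -(mk_coset_rep a Vg) e'E eE; gsimp. Qed.

Lemma tensor_act_linear : linear (tensor_act (X := X) (Y := Y) (V := V) g V').
Proof. exact: (tpow_reindex_linear eK e'K). Qed.

Lemma coef_act eta (x : QG V) : right_inv V' eta ->
  coef eta (tensor_act g V' x) = coef (fun z => eta (z * g^-1)) x.
Proof.
move=> eV'; have E := ycoef_reindex eK e'K
  (fun d => eta (coset_rep (set_val d))) x (fin_cosets fV) (fin_cosets fV').
refine (eq_trans E _).
congr (ycoef _ x); apply/funext => d /=.
by rewrite right_inv_rep.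
Qed.

Lemma right_inv_act eta : right_inv V' eta -> right_inv V (fun z => eta (z * g^-1)).
Proof.
by move=> eV' z u Vu; have := eV' (z * g^-1) _ (conjV' Vu); gsimp.
Qed.

End Act.

End GroupCoef.

Lemma malg_sum_delta (R R' : nzRingType) (K : choiceType) (p : {malg R[K]}) (k : K)
    (F : R -> R') : F 0%R = 0%R ->
  (\sum_(y <- msupp p) F p@_y * (y == k)%:R)%R = F p@_k.
Proof.
move=> F0; have [ks|ks] := boolP (k \in msupp p).
  rewrite (bigD1_seq k) ?fset_uniq//= eqxx mulr1 big1 ?addr0// => y /negbTE ->.
  by rewrite mulr0.
rewrite mcoeff_outdom// F0 big_seq big1// => y ys.
by case: eqP ys ks => [->->//|_ _ _]; rewrite mulr0.
Qed.

Section FrobCoef.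
Variables (G : profiniteGroupType) (X Y : choiceType).
Local Notation T := (freeCRing X).
Local Notation Q := {malg T[Y]}.
Local Notation QG := (QG X Y).
Implicit Types (H U V : set G) (eta : G -> Y).

Lemma coefZ U eta r (x : QG U) : fin_subgroup U ->
  coef eta (r *: x)%R = (r * coef eta x)%R.
Proof. by move=> fU; exact: linear_morphZ (coef_linear eta fU). Qed.

Lemma coef_sum U eta I (s : seq I) (P : pred I) (F : I -> QG U) : fin_subgroup U ->
  coef eta (\sum_(i <- s | P i) F i)%R = (\sum_(i <- s | P i) coef eta (F i))%R.
Proof. by move=> fU; exact: linear_morph_sum (coef_linear eta fU). Qed.

Section FrobLift.
Variables (V U : set G).
Hypotheses (fV : fin_subgroup V) (fU : fin_subgroup U) (UV : U `<=` V).

(** The basis tensor of [y] goes to the basis tensor of its pullback to [G/U]. Hence only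
    [V]-invariant indices [eta] occur, and each comes from exactly one [y]. *)
Lemma coef_frob_lift eta (x : QG V) : right_inv U eta ->
  coef eta (frob_lift U x) =
  if `[< right_inv V eta >] then frob (coset_index V U) (coef eta x) else 0%R.
Proof.
move=> eU; rewrite /frob_lift; set p := inv_iso _ _.
have Vg := fV.1; have Ug := fU.1.
pose y0 (d : left_cosets [set: G] V) := eta (coset_rep (set_val d)).
have py0 : p@_y0 = coef eta x by exact: inv_tpow_basisE (fin_cosets fV) _ _.
rewrite coef_sum//.
have E (y : left_cosets [set: G] V -> Y) : coef eta
      (tens (fun c : left_cosets [set: G] U =>
         << y (mk_coset (coset_rep (set_val c)) V) >>%R : Q)) =
    (eta == (fun z => y (mk_coset z V)))%:R%R.
  have yU := right_invW UV (right_inv_mk_coset y Vg).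
  exact: (coef_gtens X fU eU yU).
under eq_bigr => y _ do rewrite coefZ// E.
case: asboolP => eV; last first.
  apply: big1 => y _; case: eqP => [e|_]; last by rewrite mulr0.
  by case: eV; rewrite e; exact: right_inv_mk_coset.
have e1 y : (eta == (fun z => y (mk_coset z V))) = (y == y0).
  apply/eqP/eqP => [e|->].
    rewrite -(right_inv_cosets y Vg); apply/funext => d.
    by rewrite /y0 [in RHS]e.
  by apply/funext => z; rewrite /y0 /= right_inv_rep.
under eq_bigr => y _ do rewrite e1.
rewrite -py0; apply: (malg_sum_delta p y0 (F := frob (coset_index V U))).
exact: rmorph0.
Qed.

End FrobLift.

Section Power.
Variables (V U : set G).
Hypotheses (fV : fin_subgroup V) (fU : fin_subgroup U) (UV : U `<=` V).
Variable rep : left_cosets [set: G] V -> G.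
Hypothesis repP : forall c : left_cosets [set: G] V, set_val c (rep c).

Let Vg := fV.1.
Let Ug := fU.1.

Let e := coset_prod (U := U) rep.

Lemma rep_mk_coset z : V ((rep (mk_coset z V))^-1 * z).
Proof.
have : left_coset z V (rep (mk_coset z V)) := repP (mk_coset z V).
by rewrite left_cosetE//= => /(subgroupV Vg); gsimp.
Qed.

Lemma mk_coset_rep_choice (a : left_cosets [set: G] V) : mk_coset (rep a) V = a.
Proof.
rewrite -{2}(mk_coset_rep a Vg); apply: mk_coset_eq => //.
by have := rep_mk_coset (coset_rep (set_val a)); rewrite mk_coset_rep.
Qed.

Lemma coset_prod_inj : injective e.
Proof.
move=> [a b] [a' b'] eab.
have h : U ((rep a * coset_rep (set_val b))^-1 *
  (rep a' * coset_rep (set_val b'))) := mk_coset_inj Ug eab.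
have [v Vv bE] : exists2 v, V v & set_val b = left_coset v U.
  by have [v Vv vb] := set_valP b; exists v => //; exact: esym vb.
have [v' Vv' bE'] : exists2 v, V v & set_val b' = left_coset v U.
  by have [v' Vv' vb] := set_valP b'; exists v' => //; exact: esym vb.
have [u Uu uE] := coset_rep_mul v Ug; have [u' Uu' uE'] := coset_rep_mul v' Ug.
rewrite bE bE' uE uE' in h.
have aa : a = a'.
  rewrite -(mk_coset_rep_choice a) -(mk_coset_rep_choice a'); apply: mk_coset_eq => //.
  have w : V (v * u) by apply: subgroupM => //; exact: UV.
  have w' : V (v' * u') by apply: subgroupM => //; exact: UV.
  by have := subgroupM Vg (subgroupM Vg w (UV h)) (subgroupV Vg w'); gsimp.
subst a'; congr pair; apply: val_inj.
refine (eq_trans bE (eq_trans _ (esym bE'))).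
apply/left_coset_eq => //; move: h; gsimp => h.
have := subgroupM Ug (subgroupM Ug Uu h) (subgroupV Ug Uu'); gsimp.
by [].
Qed.

Lemma coset_prod_surj d : exists ab, e ab = d.
Proof.
have [g gd] : exists g, mk_coset g U = d.
  by exists (coset_rep (set_val d)); exact: mk_coset_rep.
pose a := mk_coset g V; pose v := (rep a)^-1 * g.
have Vv : V v := rep_mk_coset g.
have vU : left_cosets V U (left_coset v U) by exists v.
exists (a, SigSub (mem_set vU)); rewrite /e /coset_prod /= -gd.
apply: mk_coset_eq => //; have [u Uu ->] := coset_rep_mul v Ug.
by rewrite /v; gsimp; exact: subgroupV.
Qed.

Lemma finite_coset_type : finite_set [set: left_cosets V U].
Proof. exact/finite_set_type/finite_left_cosetsS/fU.2. Qed.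

(** Since [coset_prod] is bijective, [fGV] only relabels the factors, and the coordinate is that of
    a tensor power indexed by [V/U]. *)
Lemma coef_power eta (n : QG V) : right_inv U eta ->
  coef eta (fGV rep (tens_power (left_cosets V U) n)) =
  \big[*%R/1%R]_(c \in left_cosets V U)
    coef (fun z => eta (rep (mk_coset z V) * coset_rep c)) n.
Proof.
move=> eU.
have /choice[e' e'K] := coset_prod_surj.
have eK : cancel e e' by move=> ab; apply: coset_prod_inj; rewrite e'K.
have fA := fin_cosets fV; have fB := finite_coset_type.
have fAB := finite_set_pair fA fB; have fZ := fin_cosets fU.
set v := tens_power _ n.
have E1 (p : _ -> Y) (w : QG U) := ycoef_reindex eK e'K p w fZ fAB.
have E2 (p : _ -> Y) (w : tpow Q _) := ycoef_reindex e'K eK p w fAB fZ.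
(* [fGV] is the [inv_iso] of reindexing along [e]; injectivity and one explicit preimage identify it
   with reindexing along [e']. *)
have re_inj : injective (tpow_reindex e : QG U -> tpow Q _).
  move=> w w' ww; apply: (dual_basis_inj (ycoef_dual_basis T Y fZ)) => p.
  have pe : p = (p \o e) \o e' by apply/funext => d; rewrite /= e'K.
  rewrite pe; refine (eq_trans (esym (E1 _ _)) _).
  by refine (eq_trans _ (E1 _ _)); rewrite ww.
have re : tpow_reindex e (tpow_reindex e' v) = v.
  apply: (dual_basis_inj (ycoef_dual_basis T Y fAB)) => p.
  refine (eq_trans (E1 _ _) _); refine (eq_trans (E2 _ _) _).
  by congr (ycoef _ v); apply/funext => ab; rewrite /= eK.
have K : fGV rep v = tpow_reindex e' v.
  by rewrite -[in LHS]re; exact: (inv_isoK re_inj).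
refine (eq_trans (congr1 (coef eta) K) _).
refine (eq_trans (E2 _ _) _).
refine (eq_trans (ycoef_tens_power fA fB _ _) _).
rewrite -(@big_set_type _ _ _ _ (left_cosets V U) (fun c =>
  coef (fun z => eta (rep (mk_coset z V) * coset_rep c)) n)).
rewrite (fsbig_finite _ _ fB); apply: eq_bigr => b _.
congr (ycoef _ n); apply/funext => a /=.
by rewrite right_inv_rep// mk_coset_rep.
Qed.
End Power.
End FrobCoef.

(** * Sums over cosets *)

Section FsBig.
Variables (R : Type) (idx : R) (op : Monoid.com_law idx).

Lemma fsbig_partition (I J : choiceType) (E : set I) (P : set J) (k : I -> J)
    (f : I -> R) : finite_set E -> finite_set P -> (forall i, E i -> P (k i)) ->
  \big[op/idx]_(i \in E) f i =
  \big[op/idx]_(j \in P) \big[op/idx]_(i \in E `&` k @^-1` [set j]) f i.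
Proof.
move=> fE fP kE.
transitivity (\big[op/idx]_(i \in E) \big[op/idx]_(j \in P)
    if k i == j then f i else idx).
  apply: eq_fsbigr => i /set_mem Ei.
  rewrite (fsbigD1 (k i)) ?eqxx ?fsbig1 ?Monoid.mulm1//; last exact: kE.
  by move=> j [_ /= /eqP]; rewrite eq_sym => /negbTE ->.
rewrite exchange_fsbig//; apply: eq_fsbigr => j _.
rewrite fsbig_mkcond [RHS]fsbig_mkcond; apply: eq_fsbigr => i _.
have kij : (i \in k @^-1` [set j]) = (k i == j).
  by apply/idP/eqP => [/set_mem//|h]; exact: mem_set.
by rewrite /patch in_setI kij; case: (i \in E).
Qed.

Lemma fsbig_finType (I : finType) (f : I -> R) :
  \big[op/idx]_(i \in [set: I]) f i = \big[op/idx]_i f i.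
Proof.
rewrite [RHS]fsbig_seq ?index_enum_uniq//; apply: eq_fsbigl.
by apply/seteqP; split => // i _ /=; rewrite mem_index_enum.
Qed.

End FsBig.

Lemma card_fset_setE (I : choiceType) (A : set I) : finite_set A ->
  #|` fset_set A| = \big[addn/0%N]_(i \in A) 1%N :> nat.
Proof. by move=> fA; rewrite fsbig_finite//= sum1_size. Qed.

Lemma linear_fsum (T : pzRingType) (M N : lmodType T) (f : M -> N) (I : choiceType)
    (A : set I) (F : I -> M) : finite_set A -> linear f ->
  f (\sum_(i \in A) F i)%R = (\sum_(i \in A) f (F i))%R.
Proof. by move=> fA lf; rewrite !fsbig_finite// (linear_morph_sum _ _ _ lf). Qed.

Section Index.
Variable G : profiniteGroupType.
Implicit Types (A K U V : set G).

(** Each coset [aK] splits into [|K : U|] cosets of [U], on all of which [f] takes the value [f a].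
    This is the identity that matches the exponent in the Frobenius lift. *)
Lemma prod_coset_index (R : comNzRingType) K U (f : G -> R) :
  fin_subgroup U -> fin_subgroup K -> U `<=` K -> right_inv K f ->
  (\big[*%R/1]_(c \in left_cosets [set: G] U) f (coset_rep c) =
   (\big[*%R/1]_(c \in left_cosets [set: G] K) f (coset_rep c)) ^+ coset_index K U)%R.
Proof.
move=> [Ug fU] [Kg fK] UK fKi.
rewrite (@fsbig_partition _ _ _ _ _ _ (left_cosets [set: G] K)
  (fun c => left_coset (coset_rep c) K))//; last by move=> c _; exists (coset_rep c).
rewrite [in RHS]fsbig_finite// -prodrXl -fsbig_finite//.
apply: eq_fsbigr => C /set_mem CK; set a := coset_rep C.
have aE : left_coset a K = C by exact: left_coset_rep CK.
(* The fibre over [C] consists of the [U]-cosets inside [C]; left translation by [a] will identify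
   it with [K/U]. *)
have -> : left_cosets [set: G] U `&` (fun c => left_coset (coset_rep c) K) @^-1` [set C]
    = left_cosets C U.
  apply/seteqP; split=> c.
    move=> [[z _ <-] /= e]; exists z => //.
    have [u Uu uE] := coset_rep_mul z Ug.
    rewrite -e uE left_cosetE//=; gsimp.
    exact: subgroupV Kg (UK _ Uu).
  move=> [z Cz <-]; split; first by exists z.
  have [u Uu uE] := coset_rep_mul z Ug; rewrite /= uE.
  have az : K (a^-1 * z) by move: Cz; rewrite -{1}aE left_cosetE.
  refine (eq_trans _ aE); apply/left_coset_eq => //.
  gsimp; rewrite -mulgA; apply: subgroupM => //; first exact: subgroupV Kg (UK _ Uu).
  by have := subgroupV Kg az; gsimp.
rewrite (@big_coset_reindex G _ _ _ K C U U (fun z => a * z)) //.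
- rewrite (eq_fsbigr (fun=> f a)) => [|c /set_mem [k Kk <-]].
    rewrite fsbig_finite; last exact: finite_left_cosetsS.
    by rewrite big_const_seq count_predT /coset_index -Monoid.iteropE.
  have [u Uu ->] := coset_rep_mul k Ug.
  by rewrite fKi//; apply: subgroupM => //; exact: UK.
- exact: right_invW fKi.
- by move=> z Kz; rewrite -aE left_cosetE//=; gsimp.
- by move=> b b'; gsimp.
- move=> z; rewrite -aE left_cosetE//= => az; exists (a^-1 * z) => //.
  by gsimp; exact: subgroup1.
- by move=> b u Kb Uu; apply: subgroupM => //; exact: UK.
Qed.

End Index.

(** * Transfers and the Burnside count *)

(* The structure that the argument uses of the modules [Q^{\otimes_T G/U}]: a basis
   [tbase U eta] with coordinates [tcoef eta], indexed by the functions
   [eta : G/U -> Y], written as right [U]-invariant functions on [G]; [tphi] is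
   [\phi_U^V] and [tpower] is [n |-> f_{G/V} (n^{\otimes V/U})]. *)
Record tensor_system (G : profiniteGroupType) (Y : choiceType) (T : comNzRingType) :=
  TensorSystem {
    tmod :> set G -> lmodType T;
    tcoef : forall U, (G -> Y) -> tmod U -> T;
    tbase : forall U, (G -> Y) -> tmod U;
    tact : forall (g : G) V V', tmod V -> tmod V';
    tfrob : nat -> {rmorphism T -> T};
    tphi : forall V U, tmod V -> tmod U;
    tpower : forall V U, (left_cosets [set: G] V -> G) -> tmod V -> tmod U;
    tcoef_linear : forall U eta, fin_subgroup U -> linear (@tcoef U eta : _ -> T^o);
    tcoef_inj : forall U (x y : tmod U), fin_subgroup U ->
      (forall eta, right_inv U eta -> tcoef eta x = tcoef eta y) -> x = y;
    tcoef_base : forall U eta eta', fin_subgroup U -> right_inv U eta ->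
      right_inv U eta' -> tcoef eta (tbase U eta') = (eta == eta')%:R%R;
    tbase_expand : forall U (x : tmod U), fin_subgroup U ->
      exists s : seq (G -> Y), [/\ uniq s, forall eta, eta \in s -> right_inv U eta
        & x = (\sum_(eta <- s) tcoef eta x *: tbase U eta)%R];
    tact_linear : forall g V V', fin_subgroup V -> fin_subgroup V' ->
      V' = conj_set g V -> linear (@tact g V V');
    tcoef_act : forall g V V' eta (x : tmod V), fin_subgroup V -> fin_subgroup V' ->
      V' = conj_set g V -> right_inv V' eta ->
      tcoef eta (tact g V' x) = tcoef (fun z => eta (z * g^-1)) x;
    tcoef_phi : forall V U eta (x : tmod V), fin_subgroup V -> fin_subgroup U ->
      U `<=` V -> right_inv U eta -> tcoef eta (tphi U x) =
      if `[< right_inv V eta >] then tfrob (coset_index V U) (tcoef eta x) else 0%R;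
    tcoef_power : forall V U rep eta (n : tmod V), fin_subgroup V -> fin_subgroup U ->
      U `<=` V -> (forall c, set_val c (rep c)) -> right_inv U eta ->
      tcoef eta (tpower U rep n) = \big[*%R/1%R]_(c \in left_cosets V U)
        tcoef (fun z => eta (rep (mk_coset z V) * coset_rep c)) n;
    tfrob1 : forall r, tfrob 1 r = r;
    tscalar_ind : forall P : T -> Prop,
      (forall r s, P r -> P s -> P (r + s)%R) -> (forall r, P r -> P (- r)%R) ->
      (forall r, (forall k, tfrob k r = (r ^+ k)%R) -> P r) -> forall r, P r;
    tscalar_torsion_free : forall n (r : T), (r *+ n.+1 = 0 -> r = 0)%R
  }.

Arguments tcoef_linear {G Y T} t {U} eta.

Section System.
Variables (G : profiniteGroupType) (Y : choiceType) (T : comNzRingType).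
Variable M : tensor_system G Y T.
Implicit Types (H K U V : set G) (eta : G -> Y) (g h z : G).

Section Coefs.
Variables (U : set G) (fU : fin_subgroup U).

Lemma tcoefD eta : {morph @tcoef _ _ _ M U eta : x y / (x + y)%R}.
Proof. exact: linear_morphD (tcoef_linear M eta fU). Qed.

Lemma tcoefZ eta r (x : M U) : tcoef eta (r *: x)%R = (r * tcoef eta x)%R.
Proof. exact: linear_morphZ (tcoef_linear M eta fU). Qed.

Lemma tcoef0 eta : tcoef eta (0 : M U)%R = 0%R.
Proof. exact: linear_morph0 (tcoef_linear M eta fU). Qed.

Lemma tcoefN eta (x : M U) : tcoef eta (- x)%R = (- tcoef eta x)%R.
Proof. by rewrite -scaleN1r tcoefZ mulN1r. Qed.

Lemma tcoefMn eta (x : M U) n : tcoef eta (x *+ n)%R = (tcoef eta x *+ n)%R.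
Proof. by rewrite -scaler_nat tcoefZ mulr_natl. Qed.

Lemma tcoef_sum eta I (s : seq I) (P : pred I) (F : I -> M U) :
  tcoef eta (\sum_(i <- s | P i) F i)%R = (\sum_(i <- s | P i) tcoef eta (F i))%R.
Proof. exact: linear_morph_sum (tcoef_linear M eta fU). Qed.

Lemma tcoef_fsum eta (I : choiceType) (A : set I) (F : I -> M U) : finite_set A ->
  tcoef eta (\sum_(i \in A) F i)%R = (\sum_(i \in A) tcoef eta (F i))%R.
Proof. by move=> fA; exact: linear_fsum fA (tcoef_linear M eta fU). Qed.

Lemma tmod_torsion_free n (x : M U) : (x *+ n.+1 = 0 -> x = 0)%R.
Proof.
move=> x0; apply: (tcoef_inj fU) => eta _; rewrite tcoef0.
by apply: (tscalar_torsion_free M (n := n)); rewrite -tcoefMn x0 tcoef0.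
Qed.

End Coefs.

Section Lift.
Variables (V U : set G).
Hypotheses (fV : fin_subgroup V) (fU : fin_subgroup U) (UV : U `<=` V).

Lemma tphiD (x y : M V) : tphi U (x + y)%R = (tphi U x + tphi U y)%R.
Proof.
apply: (tcoef_inj fU) => eta eU; rewrite tcoefD// !tcoef_phi//.
by case: ifP => _; rewrite ?addr0// tcoefD// rmorphD.
Qed.

Lemma tphi0 : tphi U (0 : M V)%R = 0%R.
Proof. by have /eqP := tphiD 0 0; rewrite addr0 -subr_eq0 opprD addNKr oppr_eq0 => /eqP. Qed.

Lemma tphiMn (x : M V) n : tphi U (x *+ n)%R = (tphi U x *+ n)%R.
Proof.
elim: n => [|n ih]; first by rewrite !mulr0n tphi0.
by rewrite !mulrS tphiD ih.
Qed.

Lemma tphi_fsum (I : choiceType) (A : set I) (F : I -> M V) : finite_set A ->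
  tphi U (\sum_(i \in A) F i)%R = (\sum_(i \in A) tphi U (F i))%R.
Proof.
by move=> fA; rewrite !fsbig_finite//; apply: big_morph; [exact: tphiD|exact: tphi0].
Qed.

Lemma tphi_base r eta : right_inv V eta -> tphi U (r *: tbase M V eta)%R =
  (tfrob M (coset_index V U) r *: tbase M U eta)%R.
Proof.
move=> eV; have eU := right_invW UV eV.
apply: (tcoef_inj fU) => eta' eU'; rewrite tcoef_phi//.
rewrite [RHS]tcoefZ// [in RHS]tcoef_base//.
case: asboolP => eV'; first by rewrite tcoefZ// tcoef_base// rmorphM rmorph_nat.
by case: (eta' =P eta) => [e|_]; [case: eV'; rewrite e|rewrite /= mulr0].
Qed.

End Lift.

Lemma coset_index_id U : subgroup U -> coset_index U U = 1%N.
Proof.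
by move=> Ug; rewrite /coset_index left_cosets_id// fset_set1 cardfs1.
Qed.

Lemma tphi_id U (x : M U) : fin_subgroup U -> tphi U x = x.
Proof.
move=> fU; apply: (tcoef_inj fU) => eta eU; rewrite tcoef_phi//.
by rewrite asboolT// coset_index_id ?tfrob1//; exact: fU.1.
Qed.

Section Act.
Variables (g : G) (V V' : set G).
Hypotheses (fV : fin_subgroup V) (fV' : fin_subgroup V') (V'E : V' = conj_set g V).

Lemma tact_base r eta : right_inv V eta ->
  tact g V' (r *: tbase M V eta)%R = (r *: tbase M V' (fun z => eta (z * g)%g))%R.
Proof.
move=> eV; have e'V' : right_inv V' (fun z => eta (z * g)).
  by move=> z u; rewrite V'E => -[v Vv <-]; rewrite /=; gsimp; exact: eV.
apply: (tcoef_inj fV') => eta' eV'.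
rewrite tcoef_act// !tcoefZ// !tcoef_base//; last exact: (right_inv_act V'E).
congr (_ * (nat_of_bool _)%:R)%R; apply/eqP/eqP => [<-|->].
  by apply/funext => z; gsimp.
by apply/funext => z; gsimp.
Qed.

End Act.

End System.

Section Trace.
Variables (G : profiniteGroupType) (Y : choiceType) (T : comNzRingType).
Variable M : tensor_system G Y T.

Definition ttransfer (H U : set G) (x : M U) : M U :=
  (\sum_(c \in left_cosets (normalizer_in H U) U) tact (coset_rep c) U x)%R.

Variables (H U : set G).
Hypotheses (Hg : subgroup H) (fU : fin_subgroup U) (UH : U `<=` H).

Let N := normalizer_in H U.
Let Ug : subgroup U := fU.1.
Let Ng : subgroup N := normalizer_subgroup U Hg.
Let UN : U `<=` N := normalizer_sub Ug UH.

Lemma finite_weyl : finite_set (left_cosets N U).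
Proof. exact/finite_left_cosetsS/fU.2. Qed.

Lemma weyl_rep c : left_cosets N U c -> N (coset_rep c).
Proof.
move=> [v Nv <-]; have [u Uu ->] := coset_rep_mul v Ug.
by apply: subgroupM => //; exact: UN.
Qed.

Lemma tact_normal_linear v : N v -> linear (@tact _ _ _ M v U U).
Proof. by move=> [_ vU]; exact: tact_linear. Qed.

Lemma ttransferD : {morph ttransfer H (U := U) : x y / (x + y)%R}.
Proof.
move=> x y; rewrite /ttransfer -fsbig_split//=; last exact: finite_weyl.
apply: eq_fsbigr => c /set_mem cN.
exact: (linear_morphD (tact_normal_linear (weyl_rep cN))).
Qed.

Lemma ttransfer0 : ttransfer H (0 : M U)%R = 0%R.
Proof.
apply: fsbig1 => c cN; exact: (linear_morph0 (tact_normal_linear (weyl_rep cN))).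
Qed.

Section Burnside.
Variables (E : choiceType) (e0 : E) (A : set E) (op : G -> E -> E) (beta : E -> M U).
Hypotheses (finA : finite_set A) (opA : forall v e, N v -> A e -> A (op v e)).
Hypotheses (opM : forall v w e, op (v * w) e = op v (op w e)).
Hypothesis opU : forall u e, U u -> A e -> op u e = e.
Hypothesis opbeta : forall v e, N v -> A e -> tact v U (beta e) = beta (op v e).

(** The choice depends only on the orbit as a set, so all points of an orbit receive the same
    representative. *)
Definition orbit_canon (e : E) : E := xget e0 [set op v e | v in N].

Lemma orbit_canon_mem e : A e -> exists2 v, N v & orbit_canon e = op v e.
Proof.
move=> Ae; have [v Nv ve] : [set op v e | v in N] (orbit_canon e).
  by apply: xgetPex; exists (op 1 e); exists 1 => //; exact: subgroup1.
by exists v.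
Qed.

Lemma orbit_canon_op v e : N v -> A e -> orbit_canon (op v e) = orbit_canon e.
Proof.
move=> Nv Ae; congr (xget _ _); apply/seteqP; split=> _ [w Nw <-].
  by exists (w * v); [exact: subgroupM|exact: opM].
exists (w * v^-1); first by apply: subgroupM => //; exact: subgroupV.
by rewrite -opM; gsimp.
Qed.

(* Both sides count, for each [e], the [v] that carry the chosen representative
   of the orbit of [e] to [e]: these form a coset of the stabiliser of [e]. *)
Lemma burnside_transfer :
  (\sum_(c \in left_cosets N U)
     \sum_(e \in A) if op (coset_rep c) e == e then beta e else 0)%R =
  ttransfer H (\sum_(e \in A) if orbit_canon e == e then beta e else 0)%R.
Proof.
have fN := finite_weyl.
rewrite exchange_fsbig//.
transitivity (\sum_(e \in A) \sum_(c \in left_cosets N U)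
    if op (coset_rep c) (orbit_canon e) == e then beta e else 0)%R.
  apply: eq_fsbigr => e /set_mem Ae; have [g Ng' ge] := orbit_canon_mem Ae.
  pose f v := (if op v e == e then beta e else 0)%R.
  (* Right translation by [g], which carries [e] to its representative, turns stabilising [e] into
     carrying the representative to [e]. *)
  rewrite (@big_coset_reindex _ _ _ _ N N U U (fun v => v * g) f)//.
  - by apply: eq_fsbigr => c _; rewrite /f ge -opM.
  - by move=> z u Uu; rewrite /f opM (opU Uu Ae).
  - by move=> v Nv; exact: subgroupM Ng Nv Ng'.
  - move=> a b; gsimp; rewrite -(mulgA g^-1); split=> h.
      by have := normalizer_conj Ng' h; gsimp.
    by have := normalizer_conjV Ng' h; gsimp.
  - move=> a Na; exists (a * g^-1).
      by apply: subgroupM => //; exact: subgroupV.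
    by gsimp; exact: subgroup1.
  - by move=> a u Na Uu; apply: subgroupM => //; exact: UN.
rewrite exchange_fsbig// /ttransfer; apply: eq_fsbigr => c /set_mem cN.
have Nv := weyl_rep cN; set v := coset_rep c in Nv *.
rewrite (linear_fsum _ finA (tact_normal_linear Nv)).
have op1 e : A e -> op 1 e = e by move=> Ae; apply: opU => //; exact: subgroup1.
(* Substituting [op v e] for [e] leaves the condition that [e] is its own representative, and
   equivariance of [beta] produces the action of [v]. *)
rewrite (reindex_fsbig (op v) A).
  apply: eq_fsbigr => e /set_mem Ae; rewrite orbit_canon_op//.
  have -> : (op v (orbit_canon e) == op v e) = (orbit_canon e == e).
    apply/eqP/eqP => [h|->//]; have [w Nw we] := orbit_canon_mem Ae.
    have Ace : A (orbit_canon e) by rewrite we; exact: opA.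
    by have := congr1 (op v^-1) h; rewrite -!opM mulVg !op1.
  case: ifP => _; first by rewrite opbeta.
  by rewrite (linear_morph0 (tact_normal_linear Nv)).
split.
- by move=> e; exact: opA.
- move=> e e' /set_mem Ae /set_mem Ae' h.
  by have := congr1 (op v^-1) h; rewrite -!opM mulVg !op1.
- move=> e Ae; exists (op v^-1 e); last by rewrite -opM mulgV op1.
  by apply: opA => //; exact: subgroupV.
Qed.

End Burnside.
End Trace.

Section FinSubgroup.
Variable G : profiniteGroupType.
Implicit Types (g : G) (U V K : set G).

Lemma fin_subgroupS U V : fin_subgroup U -> subgroup V -> U `<=` V -> fin_subgroup V.
Proof.
move=> [Ug fU] Vg UV; split=> //.
apply: (@sub_finite_set _ _
  ((fun c => left_coset (coset_rep c) V) @` left_cosets [set: G] U)).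
  move=> _ [z _ <-]; exists (left_coset z U); first by exists z.
  have [u Uu ->] := coset_rep_mul z Ug.
  by apply/left_coset_eq => //; gsimp; apply: subgroupV => //; exact: UV.
exact: finite_image.
Qed.

Lemma fin_subgroup_conj g U : fin_subgroup U -> fin_subgroup (conj_set g U).
Proof.
move=> [Ug fU]; have U'g := conj_set_subgroup g Ug; split=> //.
apply: (@sub_finite_set _ _
  ((fun c => left_coset (coset_rep c * g^-1) (conj_set g U)) @`
   left_cosets [set: G] U)).
  move=> _ [z _ <-]; exists (left_coset (z * g) U); first by exists (z * g).
  have [u Uu ->] := coset_rep_mul (z * g) Ug.
  apply/left_coset_eq => //; rewrite conj_setE//=; gsimp.
  exact: subgroupV.
exact: finite_image.
Qed.

End FinSubgroup.

(** * Colourings *)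

Section GenCoset.
Variables (G : profiniteGroupType) (H U : set G).
Hypotheses (Hg : subgroup H) (fU : fin_subgroup U) (UH : U `<=` H).

Lemma gen_coset_mem v : subgroup U -> gen_subgroup (left_coset v U) v.
Proof. by move=> Ug K _; apply; exact: mem_left_coset. Qed.

Lemma gen_coset_sub v : subgroup U -> U `<=` gen_subgroup (left_coset v U).
Proof.
move=> Ug u Uu K Kg vK; have Kv : K v by apply: vK; exact: mem_left_coset.
have Kvu : K (v * u) by apply: vK; exists u.
by have := subgroupM Kg (subgroupV Kg Kv) Kvu; gsimp.
Qed.

Lemma gen_coset_min v K : subgroup K -> K v -> U `<=` K ->
  gen_subgroup (left_coset v U) `<=` K.
Proof.
by move=> Kg Kv UK x; apply=> // _ [u Uu <-]; apply: subgroupM => //; exact: UK.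
Qed.

Lemma fin_gen_coset v : fin_subgroup (gen_subgroup (left_coset v U)).
Proof.
by apply: (fin_subgroupS fU); [exact: subgroup_gen|exact: gen_coset_sub fU.1].
Qed.

End GenCoset.

Section Colour.
Variables (G : profiniteGroupType) (Y : choiceType) (T : comNzRingType).
Variable M : tensor_system G Y T.
Variables (H V : set G) (Hg : subgroup H) (fV : fin_subgroup V) (VH : V `<=` H).
Variables (rep : left_cosets [set: G] V -> G) (repP : forall c, set_val c (rep c)).
Implicit Types (K U : set G) (eta : G -> Y) (g h z : G).

Let Vg : subgroup V := fV.1.
Let rho z := rep (mk_coset z V).

Let rhoP z : V ((rho z)^-1 * z).
Proof. exact: (rep_mk_coset fV repP). Qed.

Let rhoP' z : V (z^-1 * rho z).
Proof. by have := subgroupV Vg (rhoP z); gsimp. Qed.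

Let rhoV : right_inv V rho.
Proof. exact: right_inv_mk_coset. Qed.

Let rho_rho z v : V v -> rho (rho z * v) = rho z.
Proof. by move=> Vv; rewrite (rhoV _ Vv); have := rhoV z (rhoP' z); gsimp. Qed.

(** The [V]-summand of the ghost component at [K]. *)
Definition ghost_term K (n : M V) : M K :=
  (\sum_(C \in fixed_cosets H V K)
     tact (coset_rep C) K (tpower (conj_set (coset_rep C)^-1 K) rep n))%R.

(** Membership in [H] and the fixed-point condition depend only on the coset [hV], because [V] lies
    in [H]; so they hold for the chosen representative. *)
Lemma fixed_cosetsP K C : fixed_cosets H V K C ->
  [/\ H (coset_rep C), conj_set (coset_rep C)^-1 K `<=` V & left_coset (coset_rep C) V = C].
Proof.
move=> [h [Hh hK] <-]; have [v Vv vE] := coset_rep_mul h Vg; rewrite vE; split.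
- by apply: subgroupM => //; exact: VH.
- move=> _ [k Kk <-]; have hk : V (h^-1 * k * h) by apply: hK; exists k => //; gsimp.
  by have := subgroupM Vg (subgroupM Vg (subgroupV Vg Vv) hk) Vv; gsimp.
- by apply/left_coset_eq => //; gsimp; exact: subgroupV.
Qed.

Lemma finite_fixed_cosets K : finite_set (fixed_cosets H V K).
Proof.
by apply: (sub_finite_set _ fV.2) => _ [h _ <-]; exists h.
Qed.

Lemma tcoef_term h K eta (n : M V) : fin_subgroup K -> conj_set h^-1 K `<=` V ->
  right_inv K eta -> tcoef eta (tact h K (tpower (conj_set h^-1 K) rep n)) =
  \big[*%R/1%R]_(c \in left_cosets V (conj_set h^-1 K))
    tcoef (fun z => eta (rho z * coset_rep c * h^-1)) n.
Proof.
move=> fK hK eK; have fK' := fin_subgroup_conj h^-1 fK.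
have KE : K = conj_set h (conj_set h^-1 K) by rewrite conj_setM mulgV conj_set1.
rewrite (tcoef_act _ fK' fK KE)// tcoef_power//.
exact: right_inv_act KE _ eK.
Qed.

Section Sum.
Variables (I : finType) (r : option I -> T) (y : option I -> G -> Y).
Hypotheses (r1 : r None = 1%R) (yV : forall i, right_inv V (y (Some i))).
Hypothesis rfrob : forall k i, tfrob M k (r (Some i)) = (r (Some i) ^+ k)%R.

(** The terms are indexed by [Some i]. The extra colour [None] marks points outside the support of a
    colouring, where weight 1 leaves products unchanged. *)
Let n : M V := (\sum_i r (Some i) *: tbase M V (y (Some i)))%R.

(* Encodes a family [V / h^-1 K h -> I] as a right [K]-invariant function on the
   right coset [V h^-1], independently of the choice of [h] in [hV]; the maps for
   varying [K] then become inclusions. *)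
Definition has_support h (e : G -> option I) := forall z, e z <> None <-> V (z * h).

Definition colorings K : set (G -> option I) :=
  [set e | exists2 h, H h & has_support h e /\ right_inv K e].

Definition support_rep e := xget 1 [set h | H h /\ has_support h e].

(** The function on [G/K] given by the family [e]. With [z * h = g * s], where [g] is the chosen
    representative of [zhV] and [s] lies in [V], the point [z] uses the colour at
    [s * h^-1 = g^-1 * z] and evaluates its [y] at the coset [zhV]. *)
Definition color_eta h (e : G -> option I) : G -> Y :=
  fun z => y (e ((rho (z * h))^-1 * z)) (z * h).

Definition color_base K (e : G -> option I) : M K :=
  ((\big[*%R/1]_(c \in left_cosets [set: G] K) r (e (coset_rep c))) *:
     tbase M K (color_eta (support_rep e) e))%R.

Lemma support_repP K e : colorings K e -> H (support_rep e) /\ has_support (support_rep e) e.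
Proof.
move=> [h Hh [he _]].
exact: (@xgetPex _ 1 [set h | H h /\ has_support h e] (ex_intro _ h (conj Hh he))).
Qed.

Lemma has_support_coset h h' e : has_support h e -> has_support h' e -> V (h^-1 * h').
Proof. by move=> he he'; apply/he'/he; rewrite mulVg; exact: subgroup1. Qed.

Lemma has_supportM h v e : V v -> has_support h e -> has_support (h * v) e.
Proof.
move=> Vv he z; rewrite he mulgA; split=> [zh|zhv]; first exact: subgroupM.
by have := subgroupM Vg zhv (subgroupV Vg Vv); gsimp.
Qed.

(** The two choices differ by an element of [V] on the right, which affects neither the
    representative nor the value of a [V]-invariant [y]; the colour met is never [None]. *)
Lemma color_eta_indep h h' e : has_support h e -> has_support h' e ->
  color_eta h e = color_eta h' e.
Proof.
move=> he he'; have hh := has_support_coset he he'.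
apply/funext => z; rewrite /color_eta -(mulVKg h h') mulgA (rhoV _ hh).
case E : (e _) => [i|]; first by rewrite (yV _ _ hh).
by have /he[] : V ((rho (z * h))^-1 * z * h) by rewrite -mulgA; exact: rhoP.
Qed.

Lemma color_eta_inv K h e : has_support h e -> right_inv K e -> right_inv K (color_eta h e).
Proof.
move=> he eK z k Kk; rewrite /color_eta.
have hk : V (h^-1 * k * h).
  apply/he; rewrite eK//; apply/he; rewrite mulVg; exact: subgroup1.
have -> : z * k * h = z * h * (h^-1 * k * h) by gsimp.
rewrite (rhoV _ hk) mulgA (eK _ _ Kk).
case E : (e _) => [i|]; first by rewrite (yV _ _ hk).
by have /he[] : V ((rho (z * h))^-1 * z * h) by rewrite -mulgA; exact: rhoP.
Qed.

Lemma tcoef_n eta : right_inv V eta ->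
  tcoef eta n = (\sum_i r (Some i) * (eta == y (Some i))%:R)%R.
Proof.
move=> eV; rewrite tcoef_sum//; apply: eq_bigr => i _.
by rewrite tcoefZ// tcoef_base.
Qed.

Section OneCoset.
Variables (K : set G) (fK : fin_subgroup K) (h : G) (hK : conj_set h^-1 K `<=` V).

Let K' := conj_set h^-1 K.
Let fK' : fin_subgroup K' := fin_subgroup_conj h^-1 fK.
Let Kg : subgroup K := fK.1.
Let K'g : subgroup K' := fK'.1.
Let D := fset_set (left_cosets V K').

Let fD : finite_set (left_cosets V K').
Proof. exact/finite_left_cosetsS/fK'.2. Qed.

Let inD c : (c \in D) <-> left_cosets V K' c.
Proof. by rewrite /D in_fset_set//; split => [/set_mem|/mem_set]. Qed.

Let coset_in z : left_cosets V K' (left_coset z K') <-> V z.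
Proof.
split=> [[v Vv /esym e]|Vz]; last by exists z.
have := mem_left_coset z K'g; rewrite e => -[k Kk <-].
by apply: subgroupM => //; exact: hK.
Qed.

(** The substitution of [z * h] for [z] carries the [K]-cosets in [V h^-1] to the [K']-cosets in
    [V]. A map from [V/K'] to [I] thus becomes a colouring, and every [K]-invariant colouring with
    this support arises once. *)
Let color_of (f : {ffun D -> I}) : G -> option I :=
  fun z => omap f (insub (left_coset (z * h) K')).

Let color_of_val f (d : D) : color_of f (coset_rep (val d) * h^-1) = Some (f d).
Proof.
rewrite /color_of mulgVK (left_coset_rep (A := V) K'g); last exact/inD/valP.
by rewrite valK.
Qed.

Let conjK' k : K k -> K' (h^-1 * k * h).
Proof. by move=> Kk; exists k => //; gsimp. Qed.

Let color_of_inv f : right_inv K (color_of f).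
Proof.
move=> z k Kk; congr (omap f (insub _)); apply/left_coset_eq => //; gsimp.
exact: conjK' (subgroupV Kg Kk).
Qed.

Let color_of_supp f : has_support h (color_of f).
Proof.
move=> z; rewrite /color_of -coset_in -inD; case: insubP => [d -> _|/negbTE ->] //=.
Qed.

Let color_of_bij : set_bij [set: {ffun D -> I}]
  [set e | has_support h e /\ right_inv K e] color_of.
Proof.
split.
- by move=> f _; split.
- move=> f f' _ _ ff; apply/ffunP => d; apply: Some_inj.
  by rewrite -!color_of_val ff.
move=> e [he eK].
have /choice[f fE] : forall d : D, exists i, e (coset_rep (val d) * h^-1) = Some i.
  move=> d; case E : (e _) => [i|]; first by exists i.
  have Vd : V (coset_rep (val d)).
    apply/coset_in; rewrite (left_coset_rep (A := V) K'g) //; exact/inD/valP.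
  by have /he[] : V (coset_rep (val d) * h^-1 * h) by gsimp.
exists [ffun d => f d] => //; apply/funext => z; rewrite /color_of.
case: insubP => [d _ dE|] /=.
  rewrite ffunE -fE dE; have [k' [k Kk kk] ->] := coset_rep_mul (z * h) K'g.
  have -> : z * h * k' * h^-1 = z * k by rewrite -kk; gsimp.
  exact: eK.
move/negP; rewrite inD coset_in => nV; case E : (e z) => [i|//].
by case: nV; apply/he; rewrite E.
Qed.

Lemma fsum_color (R : Type) (idx : R) (op : Monoid.com_law idx) (F : _ -> R) :
  \big[op/idx]_(e \in [set e | has_support h e /\ right_inv K e]) F e =
  \big[op/idx]_(f : {ffun D -> I}) F (color_of f).
Proof. by rewrite (reindex_fsbig _ _ _ _ color_of_bij) fsbig_finType. Qed.

Lemma finite_color : finite_set [set e | has_support h e /\ right_inv K e].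
Proof.
have [_ _ s] := color_of_bij; apply: (sub_finite_set s).
exact/finite_image/finite_finset.
Qed.

Let prod_color f : \big[*%R/1%R]_(c \in left_cosets [set: G] K) r (color_of f (coset_rep c)) =
  (\prod_(d : D) r (Some (f d)))%R.
Proof.
rewrite (@big_coset_reindex _ _ _ _ [set: G] [set: G] K' K (fun z => z * h^-1)
  (fun z => r (color_of f z))) //.
- rewrite (eq_fsbigr (fun c => r (omap f (insub c)))); last first.
    move=> c /set_mem cK; rewrite /color_of mulgVK.
    by rewrite (left_coset_rep K'g cK).
  rewrite -(fsbig_widen (left_cosets V K')).
  - rewrite fsbig_finite// -[LHS]/(\prod_(c <- D) r (omap f (insub c)))%R.
    by rewrite big_seq_fsetE; apply: eq_bigr => d _; rewrite valK.
  - by move=> _ [v _ <-]; exists v.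
  (* Cosets outside [V] carry the colour [None], of weight 1. *)
  move=> c [_ nc]; rewrite /= insubN//; apply/negP; by rewrite inD.
- by move=> z k Kk; rewrite color_of_inv.
- move=> a b; rewrite /K' conj_setE//=; gsimp; by [].
- move=> a _; exists (a * h) => //; gsimp; exact: subgroup1.
Qed.

(** Every [w] has the form [rho (w * h) * s * h^-1] with [s] in [V], so equality of the two
    functions splits into one condition for each coset [sK']. *)
Let eta_color f eta : right_inv K eta ->
  (eta == color_eta h (color_of f)) =
  [forall d : D, (fun z => eta (rho z * coset_rep (val d) * h^-1)) == y (Some (f d))].
Proof.
move=> eK; apply/eqP/forallP => [-> d|e].
  have Vd : V (coset_rep (val d)).
    apply/coset_in; rewrite (left_coset_rep (A := V) K'g) //; exact/inD/valP.
  apply/eqP/funext => z; rewrite /color_eta mulgVK rho_rho//.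
  rewrite !mulgA mulVg mul1g color_of_val.
  by rewrite yV// -(yV (f d) z (rhoP' z)); gsimp.
apply/funext => w; rewrite /color_eta.
pose s := (rho (w * h))^-1 * (w * h).
have Vs : V s by exact: rhoP.
have sD : left_coset s K' \in D by apply/inD/coset_in.
have /eqP ed := e [` sD]%fset.
have := congr1 (fun f => f (w * h)) ed; rewrite /=.
have [k' [k Kk kk] ->] := coset_rep_mul s K'g.
have -> : rho (w * h) * (s * k') * h^-1 = w * k by rewrite -kk /s; gsimp.
rewrite eK// => ->; congr (y _ _).
rewrite /color_of -mulgA -/s insubT//=; congr (Some (f _)).
Qed.

Lemma tcoef_term_color eta : right_inv K eta ->
  tcoef eta (tact h K (tpower (conj_set h^-1 K) rep n)) =
  (\sum_(e \in [set e | has_support h e /\ right_inv K e])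
    (\big[*%R/1]_(c \in left_cosets [set: G] K) r (e (coset_rep c))) *
      (eta == color_eta h e)%:R)%R.
Proof.
move=> eK; rewrite tcoef_term// fsum_color.
rewrite fsbig_finite// -[LHS]/(\prod_(c <- D) _)%R big_seq_fsetE.
transitivity (\prod_(d : D) \sum_i r (Some i) *
    ((fun z => eta (rho z * coset_rep (val d) * h^-1)%g) == y (Some i))%:R)%R.
  apply: eq_bigr => d _; rewrite tcoef_n//= => z v Vv.
  by rewrite rhoV.
(* Expanding the product of sums over [I] gives a sum over maps from [V/K'] to [I], that is, over
   colourings. *)
rewrite bigA_distr_bigA; apply: eq_bigr => f _.
rewrite prod_color eta_color// big_split /=; congr (_ * _)%R.
case: (boolP [forall d, _]) => [/forallP a|].
  by rewrite big1// => d _; rewrite a.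
rewrite negb_forall => /existsP[d /negbTE nd].
by rewrite (bigD1 d) //= nd mul0r.
Qed.

End OneCoset.

Lemma colorings_conj K h e : subgroup K -> has_support h e -> right_inv K e ->
  conj_set h^-1 K `<=` V.
Proof.
move=> Kg he eK _ [k Kk <-]; gsimp; apply/he; rewrite eK//; apply/he.
by rewrite mulVg; exact: subgroup1.
Qed.

Let kappa e := left_coset (support_rep e) V.

Lemma colorings_coset K e : subgroup K -> colorings K e -> fixed_cosets H V K (kappa e).
Proof.
move=> Kg eK; have [Hh he] := support_repP eK.
exists (support_rep e) => //; split=> //; apply: colorings_conj he _ => //.
by case: eK => h _ [].
Qed.

(** A support [V h^-1] determines the coset [hV], so colourings are partitioned by the fixed coset
    to which they belong. *)
Lemma colorings_fiber K C : subgroup K -> fixed_cosets H V K C ->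
  colorings K `&` kappa @^-1` [set C] =
  [set e | has_support (coset_rep C) e /\ right_inv K e].
Proof.
move=> Kg KC; have [HC CK CE] := fixed_cosetsP KC.
apply/seteqP; split=> e /=.
  move=> [eK ke]; split; last by case: eK => h _ [].
  have [Hh he] := support_repP eK.
  have /(left_coset_eq _ _ Vg) hC : left_coset (support_rep e) V =
    left_coset (coset_rep C) V by rewrite CE.
  by rewrite -(mulVKg (support_rep e) (coset_rep C)); exact: has_supportM.
move=> [he eK]; have eC : colorings K e by exists (coset_rep C).
split=> //; have [_ he'] := support_repP eC.
by rewrite -CE; apply/(left_coset_eq _ _ Vg); exact: has_support_coset he' he.
Qed.

Lemma finite_colorings K : fin_subgroup K -> finite_set (colorings K).
Proof.
move=> fK; have Kg := fK.1; apply: (@sub_finite_set _ _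
  (\bigcup_(C in fixed_cosets H V K) [set e | has_support (coset_rep C) e /\ right_inv K e])).
  move=> e eK; have kC := colorings_coset Kg eK; exists (kappa e) => //.
  by rewrite -colorings_fiber.
apply: bigcup_finite; first exact: finite_fixed_cosets.
by move=> C KC; apply: finite_color => //; have [] := fixed_cosetsP KC.
Qed.

Lemma ghost_term_color K : fin_subgroup K ->
  ghost_term K n = (\sum_(e \in colorings K) color_base K e)%R.
Proof.
move=> fK; have Kg := fK.1; apply: (tcoef_inj fK) => eta eK.
have fC := finite_colorings fK; have fF := finite_fixed_cosets K.
rewrite !tcoef_fsum//.
rewrite (fsbig_partition _ _ fC fF (fun e => @colorings_coset K e Kg)).
apply: eq_fsbigr => C /set_mem KC; have [HC CK CE] := fixed_cosetsP KC.
rewrite tcoef_term_color// colorings_fiber//; apply: eq_fsbigr => e /set_mem [he eK'].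
have [_ he'] : H (support_rep e) /\ has_support (support_rep e) e.
  by apply: (@support_repP K); exists (coset_rep C).
rewrite /color_base tcoefZ// tcoef_base//; last exact: color_eta_inv.
by rewrite (color_eta_indep he' he).
Qed.

(** The index function is unchanged, and the power [|K : U|] of the weight over [G/K] is the weight
    over [G/U] by [prod_coset_index]. *)
Lemma tphi_color K U e : fin_subgroup K -> fin_subgroup U -> U `<=` K ->
  colorings K e -> tphi U (color_base K e) = color_base U e.
Proof.
move=> fK fU UK eK; have [_ he] := support_repP eK.
have eKi : right_inv K e by case: eK => h _ [].
rewrite /color_base tphi_base//; last exact: color_eta_inv.
congr (_ *: _)%R; rewrite (@prod_coset_index _ _ K U (fun z => r (e z)))//; last first.
  by move=> z k Kk; rewrite eKi.
rewrite fsbig_finite /=; last exact: fK.2.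
rewrite rmorph_prod -prodrXl.
apply: eq_bigr => c _; case: (e _) => [i|]; first exact: rfrob.
by rewrite r1 rmorph1 expr1n.
Qed.

(** * The action of the normaliser on colourings *)

Section Normal.
Variables (U : set G) (fU : fin_subgroup U) (UH : U `<=` H).
Let Ug : subgroup U := fU.1.

Definition color_act v (e : G -> option I) : G -> option I := fun z => e (z * v).

Lemma color_act_support v h e : has_support h e -> has_support (v * h) (color_act v e).
Proof. by move=> he z; rewrite /color_act he mulgA. Qed.

Lemma color_actP v e : normalizer_in H U v -> colorings U e -> colorings U (color_act v e).
Proof.
move=> Nv [h Hh [he eU]]; have [Hv _] := Nv.
exists (v * h); first exact: subgroupM.
split; first exact: color_act_support.
move=> z u Uu; rewrite /color_act -(eU (z * v) _ (normalizer_conj Nv Uu)).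
by congr e; gsimp.
Qed.

(** Right translation by [v] permutes [G/U] because [v] normalises [U], so the weight is unchanged;
    the support moves from [h] to [v * h], which translates the index function accordingly. *)
Lemma tact_color v e : normalizer_in H U v -> colorings U e ->
  tact v U (color_base U e) = color_base U (color_act v e).
Proof.
move=> Nv eU; have [Hv vU] := Nv; have [_ he] := support_repP eU.
have eUi : right_inv U e by case: eU => h _ [].
have [_ he'] := support_repP (color_actP Nv eU).
rewrite /color_base tact_base//; last exact: color_eta_inv.
congr (_ *: tbase _ _ _)%R.
  rewrite (@big_coset_reindex _ _ _ _ [set: G] [set: G] U U (fun z => z * v)
    (fun z => r (e z)))//.
  - by move=> z u Uu; rewrite eUi.
  - move=> a b; gsimp; rewrite -(mulgA v^-1); split=> h.
      by have := normalizer_conj Nv h; gsimp.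
    by have := normalizer_conjV Nv h; gsimp.
  - by move=> a _; exists (a * v^-1) => //; gsimp; exact: subgroup1.
rewrite (color_eta_indep he' (color_act_support v he)).
by apply/funext => z; rewrite /color_eta /color_act !mulgA.
Qed.

Lemma colorings_gen v e : normalizer_in H U v ->
  colorings (gen_subgroup (left_coset v U)) e <-> colorings U e /\ color_act v e = e.
Proof.
move=> [Hv vU]; split=> [[h Hh [he eK]]|[[h Hh [he eU]] ve]].
  split; last by apply/funext => z; apply: eK; exact: gen_coset_mem.
  by exists h => //; split=> //; apply: right_invW eK; exact: gen_coset_sub.
exists h => //; split=> // z k kK; move: z.
(* The right stabiliser of [e] is a subgroup containing [v] and [U], hence contains the group they
   generate. *)
pose S := [set k | forall z, e (z * k) = e z].
suff: gen_subgroup (left_coset v U) `<=` S by move=> /(_ _ kK).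
apply: gen_coset_min.
- split; first by apply/mem_set => z; rewrite mulg1.
  move=> a b /set_mem aS /set_mem bS; apply/mem_set => z.
  by rewrite mulgA -(bS (z * a * b^-1)) mulgVK aS.
- by move=> z; rewrite -[in RHS]ve.
- by move=> u Uu z; exact: eU.
Qed.

(** By [colorings_gen] the terms for the coset of [v] are the colourings of [U] fixed by [v], so the
    sum has the form required by [burnside_transfer]. *)
Lemma frob_sum_ghost_term :
  (\sum_(c \in left_cosets (normalizer_in H U) U)
     tphi U (ghost_term (gen_subgroup c) n))%R =
  ttransfer H (\sum_(e \in colorings U)
    if orbit_canon H U (fun=> None) color_act e == e then color_base U e else 0)%R.
Proof.
rewrite -(@burnside_transfer _ _ _ M H U Hg fU UH _ _ (colorings U) color_act
  (color_base U)).
- apply: eq_fsbigr => c /set_mem cN; have Nv := weyl_rep Hg fU UH cN.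
  set v := coset_rep c in Nv *.
  have cE : c = left_coset v U by rewrite (left_coset_rep Ug cN).
  have fK : fin_subgroup (gen_subgroup c) by rewrite cE; exact: fin_gen_coset.
  have UK : U `<=` gen_subgroup c by rewrite cE; exact: gen_coset_sub.
  have cg e : colorings (gen_subgroup c) e <-> colorings U e /\ color_act v e = e.
    by rewrite cE; exact: colorings_gen.
  rewrite ghost_term_color// tphi_fsum//; last exact: finite_colorings.
  rewrite fsbig_mkcond [RHS]fsbig_mkcond; apply: eq_fsbigr => e _.
  rewrite /patch; case: ifPn => [/set_mem eK|].
    have [eU ve] := (cg e).1 eK.
    by rewrite (mem_set eU) ve eqxx tphi_color.
  case: ifP => // /set_mem eU; case: eqP => // ve.
  by rewrite mem_set//; apply/cg.
- exact: finite_colorings.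
- by move=> v e; exact: color_actP.
- by move=> v w e; apply/funext => z; rewrite /color_act mulgA.
- by move=> u e Uu [h _ [_ eU]]; apply/funext => z; exact: eU.
- by move=> v e; exact: tact_color.
Qed.

End Normal.
End Sum.
End Colour.

(** * Congruences *)

Section Congruence.
Local Open Scope ring_scope.
Variable N : nat.

Definition cong_mul (A : zmodType) (x y : A) : Prop := exists z, x = y + z *+ N.

Lemma cong_refl (A : zmodType) (x : A) : cong_mul x x.
Proof. by exists 0; rewrite mul0rn addr0. Qed.

Lemma congD (A : zmodType) (x y x' y' : A) :
  cong_mul x x' -> cong_mul y y' -> cong_mul (x + y) (x' + y').
Proof. by move=> [a ->] [b ->]; exists (a + b); rewrite mulrnDl addrACA. Qed.

Lemma congM (A : comNzRingType) (x y x' y' : A) :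
  cong_mul x x' -> cong_mul y y' -> cong_mul (x * y) (x' * y').
Proof.
move=> [a ->] [b ->]; exists (a * y' + x' * b + (a * b) *+ N).
rewrite mulrDl !mulrDr !mulrnDl !mulrnAl !mulrnAr -addrA; congr (_ + _).
by rewrite addrA [_ *+ N + _]addrC.
Qed.

Lemma cong_fsum (A : zmodType) (I : choiceType) (B : set I) (F F' : I -> A) :
  finite_set B -> (forall i, B i -> cong_mul (F i) (F' i)) ->
  cong_mul (\sum_(i \in B) F i) (\sum_(i \in B) F' i).
Proof.
move=> fB FF; rewrite !fsbig_finite//= big_seq [X in cong_mul _ X]big_seq.
elim/big_ind2: _ => [|x x' y y'|i]; [exact: cong_refl|exact: congD|].
by rewrite in_fset_set// => /set_mem; exact: FF.
Qed.

Lemma cong_fprod (A : comNzRingType) (I : choiceType) (B : set I) (F F' : I -> A) :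
  finite_set B -> (forall i, B i -> cong_mul (F i) (F' i)) ->
  cong_mul (\big[*%R/1]_(i \in B) F i) (\big[*%R/1]_(i \in B) F' i).
Proof.
move=> fB FF; rewrite !fsbig_finite//= big_seq [X in cong_mul _ X]big_seq.
elim/big_ind2: _ => [|x x' y y'|i]; [exact: cong_refl|exact: congM|].
by rewrite in_fset_set// => /set_mem; exact: FF.
Qed.

Lemma cong_linear (T : pzRingType) (A B : lmodType T) (f : A -> B) x y :
  linear f -> cong_mul x y -> cong_mul (f x) (f y).
Proof.
move=> lf [z ->]; exists (f z).
by rewrite (linear_morphD lf) -!scaler_nat (linear_morphZ _ _ lf).
Qed.

End Congruence.

(** * Effective elements and a single ghost summand *)

Section OneSubgroup.
Variables (G : profiniteGroupType) (Y : choiceType) (T : comNzRingType).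
Variable M : tensor_system G Y T.
Implicit Types (H K U V : set G) (eta : G -> Y) (g h z : G).

(** The quotients found on the finitely many nonzero coordinates of [x - y] assemble to one element.
    This makes congruences accessible for the non-additive power map. *)
Lemma cong_coef N U (x y : M U) : fin_subgroup U ->
  (forall eta, right_inv U eta -> cong_mul N (tcoef eta x) (tcoef eta y)) ->
  cong_mul N x y.
Proof.
move=> fU h; have [s [_ sU xy]] := tbase_expand (x - y)%R fU.
have /choice[t tE] : forall eta, exists t, right_inv U eta ->
    tcoef eta x = (tcoef eta y + t *+ N)%R.
  move=> eta; have [eU|neU] := pselect (right_inv U eta); last by exists 0%R.
  by have [t tE] := h _ eU; exists t.
exists (\sum_(eta <- s) t eta *: tbase M U eta)%R.
rewrite -sumrMnl -[LHS](subrK y) addrC; congr (_ + _)%R; rewrite [LHS]xy.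
rewrite big_seq [RHS]big_seq; apply: eq_bigr => eta /sU eU.
by rewrite tcoefD// tcoefN// tE// addrAC subrr add0r scalerMnl.
Qed.

(** Conjugation carries [V]-invariant indices to [V']-invariant ones and preserves the index of [U]
    in [V], hence the Frobenius exponent. *)
Lemma tact_phi g V V' U U' (x : M V) :
  fin_subgroup V -> fin_subgroup V' -> fin_subgroup U -> fin_subgroup U' ->
  V' = conj_set g V -> U' = conj_set g U -> U `<=` V ->
  tact g U' (tphi U x) = tphi U' (tact g V' x).
Proof.
move=> fV fV' fU fU' V'E U'E UV; have UV' : U' `<=` V'.
  by rewrite U'E V'E; exact: conj_setS.
apply: (tcoef_inj fU') => eta eU'; rewrite (tcoef_act _ fU fU' U'E)//.
rewrite tcoef_phi//; last exact: right_inv_act U'E _ eU'.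
rewrite tcoef_phi//.
have -> : `[< right_inv V (fun z => eta (z * g^-1)) >] = `[< right_inv V' eta >].
  apply: asbool_equiv_eq; split=> [eV z u|]; last exact: right_inv_act.
  rewrite V'E => -[v Vv <-].
  by have := eV (z * g) v Vv; gsimp.
case: asboolP => // eV'; rewrite (tcoef_act _ fV fV' V'E)//.
congr (tfrob M _ _).
have Vg := fV.1; have Ug := fU.1; have U'g := fU'.1.
have fVU : finite_set (left_cosets V U) by exact/finite_left_cosetsS/fU.2.
have fVU' : finite_set (left_cosets V' U') by exact/finite_left_cosetsS/fU'.2.
rewrite /coset_index.
rewrite !card_fset_setE// (@big_coset_reindex _ _ _ _ V V' U U'
  (fun z => g * z * g^-1) (fun=> 1%N))//.
- by move=> a Va; rewrite V'E; exists a.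
- by move=> a b; rewrite U'E conj_setE//=; gsimp.
- move=> a; rewrite V'E => -[v Vv <-]; exists v => //.
  by rewrite mulVg; exact: subgroup1.
- by move=> a u Va /UV; exact: subgroupM.
Qed.

(* The Burnside count needs nonnegative multiplicities. *)
Definition effective V (x : M V) : Prop :=
  exists l : seq (T * (G -> Y)),
    (forall p, p \in l -> (forall k, tfrob M k p.1 = (p.1 ^+ k)%R) /\ right_inv V p.2) /\
    x = (\sum_(p <- l) p.1 *: tbase M V p.2)%R.

Lemma effectiveD V (x y : M V) : effective x -> effective y -> effective (x + y)%R.
Proof.
move=> [l [lP ->]] [l' [lP' ->]]; exists (l ++ l'); rewrite big_cat; split=> // p.
by rewrite mem_cat => /orP[/lP|/lP'].
Qed.

Lemma effective0 V : effective (0 : M V)%R.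
Proof. by exists [::]; rewrite big_nil. Qed.

Lemma effectiveMn V (x : M V) n : effective x -> effective (x *+ n)%R.
Proof.
move=> ex; elim: n => [|n ih]; first by rewrite mulr0n; exact: effective0.
by rewrite mulrS; exact: effectiveD.
Qed.

Lemma effective_approx N V (x : M V) : fin_subgroup V ->
  exists2 x', effective x' & cong_mul N.+1 x' x.
Proof.
move=> fV; pose P x := exists2 x' : M V, effective x' & cong_mul N.+1 x' x.
have PD a b : P a -> P b -> P (a + b)%R.
  by move=> [a' ea ca] [b' eb cb]; exists (a' + b')%R; [exact: effectiveD|exact: congD].
have PN a : P a -> P (- a)%R.
  (* Modulo [N.+1], the element [- a] is congruent to [N] times [a], hence to an effective
     element. *)
  move=> [a' ea [c aE]]; exists (a' *+ N)%R; first exact: effectiveMn.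
  exists (a + c *+ N)%R.
  rewrite aE mulrnDl mulrnDl -!mulrnA mulnC.
  by rewrite [in RHS]mulrS !addrA addNr add0r.
have [s [_ sV ->]] := tbase_expand x fV; rewrite -/(P _) big_seq.
apply: big_ind => [||eta /sV eV]; first by
    exists 0%R; [exact: effective0|exact: cong_refl].
  exact: PD.
move: (tcoef eta x); apply: (tscalar_ind (t := M)).
- by move=> r r' Pr Pr'; rewrite scalerDl; exact: PD.
- by move=> r Pr; rewrite scaleNr; exact: PN.
- move=> r rP; exists (r *: tbase M V eta)%R; last exact: cong_refl.
  exists [:: (r, eta)]; rewrite big_seq1; split=> // p.
  by rewrite inE => /eqP ->.
Qed.

Section Term.
Variables (H V : set G) (Hg : subgroup H) (fV : fin_subgroup V) (VH : V `<=` H).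
Variables (rep : left_cosets [set: G] V -> G) (repP : forall c, set_val c (rep c)).

Let Vg : subgroup V := fV.1.
Let rho z := rep (mk_coset z V).

Lemma cong_ghost_term N K (n n' : M V) : fin_subgroup K -> cong_mul N n n' ->
  cong_mul N (ghost_term H rep K n) (ghost_term H rep K n').
Proof.
move=> fK nn; apply: cong_fsum; first exact: finite_fixed_cosets.
move=> C KC; have [HC CK _] := fixed_cosetsP Hg fV VH KC.
apply: cong_coef => // eta eK; rewrite !tcoef_term//.
apply: cong_fprod.
  exact/finite_left_cosetsS/(fin_subgroup_conj _ fK).2.
by move=> c _; exact: (cong_linear (tcoef_linear M _ fV)).
Qed.

Lemma tact_ghost_term g K K' (n : M V) : H g -> fin_subgroup K -> K' = conj_set g K ->
  tact g K' (ghost_term H rep K n) = ghost_term H rep K' n.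
Proof.
move=> Hg' fK K'E; have fK' : fin_subgroup K' by rewrite K'E; exact: fin_subgroup_conj.
apply: (tcoef_inj fK') => eta eK'; have eK := right_inv_act K'E eK'.
have fF := finite_fixed_cosets H fV.
rewrite (tcoef_act _ fK fK' K'E)// !tcoef_fsum//.
have gP C : fixed_cosets H V K C -> fixed_cosets H V K' (left_coset (g * coset_rep C) V).
  move=> KC; have [HC CK CE] := fixed_cosetsP Hg fV VH KC.
  exists (g * coset_rep C) => //; split; first exact: subgroupM.
  by rewrite K'E conj_setM; gsimp.
(* Left translation by [g] is a bijection from the cosets fixed by [K] to those fixed by [K']. *)
rewrite [RHS](reindex_fsbig (fun C => left_coset (g * coset_rep C) V)
  (fixed_cosets H V K)); last first.
  split; first exact: gP.
    move=> C C' /set_mem KC /set_mem KC' /left_coset_eq => /(_ Vg); gsimp.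
    have [_ _ CE] := fixed_cosetsP Hg fV VH KC;
    have [_ _ CE'] := fixed_cosetsP Hg fV VH KC'.
    by rewrite -{2}CE -{2}CE' => h; apply/left_coset_eq.
  move=> C KC; have [HC CK CE] := fixed_cosetsP Hg fV VH KC.
  exists (left_coset (g^-1 * coset_rep C) V).
    exists (g^-1 * coset_rep C) => //; split; first by apply: subgroupM => //; exact: subgroupV.
    move: CK; rewrite K'E conj_setM; gsimp; exact.
  rewrite -[RHS]CE; have [v Vv ->] := coset_rep_mul (g^-1 * coset_rep C) Vg.
  by apply/left_coset_eq => //; gsimp; exact: subgroupV.
apply: eq_fsbigr => C /set_mem KC; have [HC CK CE] := fixed_cosetsP Hg fV VH KC.
have [HC' CK' CE'] := fixed_cosetsP Hg fV VH (gP _ KC).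
rewrite tcoef_term// tcoef_term//.
(* The representative chosen for the translated coset is [g * h * v] with [v] in [V]; right
   translation by [v] matches the index sets of the two products. *)
have [v Vv vE] := coset_rep_mul (g * coset_rep C) Vg.
move: CK'; rewrite vE => CK'; set h := coset_rep C in HC CK CE vE CK' *.
pose f s := tcoef (fun z => eta (rho z * s * (g * h * v)^-1)) n.
have fKh := fin_subgroup_conj h^-1 fK.
have fKv := fin_subgroup_conj (g * h * v)^-1 fK'.
rewrite -[RHS]/(\big[*%R/1%R]_(c \in left_cosets V (conj_set (g * h * v)^-1 K'))
  f (coset_rep c)).
rewrite (@big_coset_reindex _ _ _ _ V V (conj_set h^-1 K) (conj_set (g * h * v)^-1 K')
  (fun s => s * v) f).
- by apply: eq_fsbigr => c _; congr (tcoef _ n); apply/funext => z; gsimp.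
- exact: fKh.1.
- exact: fKv.1.
- move=> z _ [k Kk <-]; congr (tcoef _ n); apply/funext => w; gsimp.
  exact: eK'.
- by move=> a Va; exact: subgroupM.
- move=> a b; rewrite K'E conj_setM conj_setE ?fKh.1//; last exact: fK.1.
  by rewrite conj_setE/=; [gsimp|exact: fK.1].
- move=> a Va; exists (a * v^-1); first by apply: subgroupM => //; exact: subgroupV.
  by rewrite mulgVK mulVg; exact: subgroup1 fKv.1.
- by move=> a u Va /CK Vu; exact: subgroupM.
Qed.

End Term.
End OneSubgroup.

(** * The Dwork lemma for a tensor system *)

Section Index.
Variable G : profiniteGroupType.
Implicit Types (U V : set G).

Definition gindex U : nat := #|` fset_set (left_cosets [set: G] U)|.

Lemma gindex_image U V (A : set (set G)) : fin_subgroup U -> fin_subgroup V ->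
  A `<=` left_cosets [set: G] U ->
  (forall z, exists2 c, A c & left_coset z V = left_coset (coset_rep c) V) ->
  (gindex V <= #|` fset_set A|)%N.
Proof.
move=> [Ug fU] [Vg fV] AU h; have fA := sub_finite_set AU fU.
have -> : gindex V = #|` (fun c => left_coset (coset_rep c) V) @` fset_set A|%fset.
  rewrite -fset_set_image// /gindex; congr (#|` fset_set _|).
  apply/seteqP; split=> _ [z _ <-]; last by exists (coset_rep z).
  by have [c Ac ->] := h z; exists c.
exact: leq_imfset_card.
Qed.

Lemma gindex_le U V : fin_subgroup U -> fin_subgroup V -> U `<=` V ->
  (gindex V <= gindex U)%N.
Proof.
move=> fU fV UV; apply: (gindex_image fU fV) => // z.
exists (left_coset z U); first by exists z.
have [u Uu ->] := coset_rep_mul z fU.1.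
by apply/(left_coset_eq _ _ fV.1); gsimp; exact: UV.
Qed.

(** [U] and [vU] are distinct cosets inside [V], so [vU] can be discarded and the remaining cosets
    of [U] still meet every coset of [V]. *)
Lemma gindex_lt U V v : fin_subgroup U -> fin_subgroup V -> U `<=` V ->
  V v -> ~ U v -> (gindex V < gindex U)%N.
Proof.
move=> fU fV UV Vv nUv; have Ug := fU.1; have Vg := fV.1.
have vU : left_cosets [set: G] U (left_coset v U) by exists v.
have fC : finite_set (left_cosets [set: G] U) := fU.2.
have vC : left_coset v U \in fset_set (left_cosets [set: G] U).
  by rewrite in_fset_set//; exact: mem_set.
rewrite [gindex U](cardfsD1 (left_coset v U)) vC add1n ltnS.
rewrite -fset_setD1//; apply: (gindex_image fU fV) => [c []//|z].
have [zv|nzv] := pselect (left_coset z U = left_coset v U); last first.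
  exists (left_coset z U); first by split=> //; exists z.
  have [u Uu ->] := coset_rep_mul z Ug.
  by apply/left_coset_eq => //; gsimp; exact: UV.
exists (left_coset 1 U).
  split; first by exists 1.
  by move/left_coset_eq => /(_ Ug); gsimp.
have [u Uu ->] := coset_rep_mul 1 Ug; apply/left_coset_eq => //; gsimp.
apply: subgroupM => //; last exact: UV.
move/left_coset_eq : zv => /(_ Ug)/UV zv.
by have := subgroupM Vg zv (subgroupV Vg Vv); gsimp.
Qed.

Lemma gindex_conj g U : fin_subgroup U -> gindex (conj_set g U) = gindex U.
Proof.
move=> fU; have fU' := fin_subgroup_conj g fU.
rewrite /gindex !card_fset_setE; [|exact: fU.2|exact: fU'.2].
rewrite (@big_coset_reindex _ _ _ _ [set: G] [set: G] U (conj_set g U)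
  (fun z => z * g^-1) (fun=> 1%N))//; [exact: fU.1|exact: fU'.1| |].
- by move=> a b; rewrite conj_setE ?fU.1//=; [gsimp|exact: fU.1].
- by move=> a _; exists (a * g) => //; rewrite mulgK mulVg; exact: subgroup1 fU'.1.
Qed.

End Index.

Section Dwork.
Variables (G : profiniteGroupType) (Y : choiceType) (T : comNzRingType).
Variable M : tensor_system G Y T.
Variables (H : set G) (Hg : subgroup H) (S : set (set G)) (tS : truncation_set H S).
Variables (S0 : set (set G)) (S0P : conj_representatives H S S0).
Variable rep : forall V, left_cosets [set: G] V -> G.
Hypothesis repP : forall V, S0 V -> forall c, set_val c (rep (V := V) c).
Implicit Types (K U V : set G) (n a : forall V, M V).

Lemma trunc_fin U : S U -> fin_subgroup U.
Proof.
by move=> /(trunc_sub tS)[Ug oU _]; split=> //; exact: finite_left_cosets.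
Qed.

Lemma trunc_subH U : S U -> U `<=` H.
Proof. by move=> /(trunc_sub tS)[]. Qed.

Lemma rep_trunc V : S0 V -> S V.
Proof. exact: S0P.1. Qed.

Definition tghost n U : M U := (\sum_(V \in S0) ghost_term H (rep (V := V)) U (n V))%R.

Definition tfrob_sum a U : M U :=
  (\sum_(c \in left_cosets (normalizer_in H U) U) tphi U (a (gen_subgroup c)))%R.

(** The representatives that contribute at [U]. This set is finite even if [S0] is infinite, and
    serves as a common index set for all components above [U]. *)
Definition ghost_support U := [set V | S0 V /\ fixed_cosets H V U !=set0].

(** Every overgroup is the union of a subset of the finite set [G/U]. *)
Lemma finite_overgroups U : fin_subgroup U ->
  finite_set [set K | subgroup K /\ U `<=` K].
Proof.
move=> [Ug fU]; apply: (@sub_finite_set _ _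
  ((fun F : {fset (set G)} => \bigcup_(c in [set` F]) c) @`
    [set` fpowerset (fset_set (left_cosets [set: G] U))])); last first.
  exact/finite_image/finite_fset.
move=> K [Kg UK].
exists [fset c in fset_set (left_cosets [set: G] U) | `[< (c `<=` K)%classic >]]%fset.
  by rewrite /= fpowersetE; apply/fsubsetP => c; rewrite inE => /andP[].
apply/seteqP; split=> z.
  by move=> [c /=]; rewrite inE => /andP[_ /asboolP]; apply.
move=> Kz; exists (left_coset z U); last exact: mem_left_coset.
rewrite /= inE; apply/andP; split.
  by rewrite in_fset_set//; apply/mem_set; exists z.
by apply/asboolP => _ [u Uu <-]; apply: subgroupM => //; exact: UK.
Qed.

Lemma ghost_supportP U V : S U -> ghost_support U V -> exists h,
  [/\ H h, S (conj_set h^-1 U) & conj_set h^-1 U `<=` V].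
Proof.
move=> SU [S0V [_ [h [Hh hU] _]]]; exists h; split=> //.
by apply: (trunc_conj tS) => //; exact: subgroupV.
Qed.

Lemma finite_ghost_support U : S U -> finite_set (ghost_support U).
Proof.
move=> SU; have fU := trunc_fin SU.
(* [f] picks the representative of the class of [K]; a contributing [V] is [f] of its conjugate by
   [h], which contains [U]. *)
pose f K := xget set0 [set V | S0 V /\ exists2 h, H h & V = conj_set h K].
apply: (@sub_finite_set _ _ (f @` [set K | subgroup K /\ U `<=` K])); last first.
  exact/finite_image/finite_overgroups.
move=> V sV; have [h [Hh _ hU]] := ghost_supportP SU sV; have [S0V _] := sV.
have SV := rep_trunc S0V.
exists (conj_set h V).
  split; first exact: conj_set_subgroup (trunc_fin SV).1.
  by have := conj_setS (g := h) hU; rewrite conj_setM mulgV conj_set1.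
have [W [_ Wu]] := S0P.2 _ (trunc_conj tS Hh SV).
have VW : W = V.
  apply: Wu; split=> //; exists h^-1; first exact: subgroupV.
  by rewrite conj_setM mulVg conj_set1.
apply: xget_unique => [|V' hV']; last by rewrite -VW -(Wu _ hV').
split=> //; exists h^-1; first exact: subgroupV.
by rewrite conj_setM mulVg conj_set1.
Qed.

Lemma ghost_supportS U K : U `<=` K -> ghost_support K `<=` ghost_support U.
Proof.
move=> UK V [S0V [_ [h [Hh hK] _]]]; split=> //.
exists (left_coset h V), h => //; split=> //.
by apply: subset_trans hK; exact: conj_setS.
Qed.

Lemma tghostE n U K : S U -> U `<=` K ->
  tghost n K = (\sum_(V \in ghost_support U) ghost_term H (rep (V := V)) K (n V))%R.
Proof.
move=> SU UK; apply/esym/fsbig_widen; first by move=> V [].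
move=> V [S0V nV] /=; rewrite /ghost_term.
have -> : fixed_cosets H V K = set0; last exact: fsbig_set0.
apply: contrapT => /eqP/set0P ne; apply: nV; apply: (ghost_supportS UK).
by split.
Qed.

Lemma tghost_eq n n' U : S U -> (forall V, ghost_support U V -> n V = n' V) ->
  tghost n U = tghost n' U.
Proof.
move=> SU nn; rewrite !(tghostE _ SU (@subset_refl _ U)).
by apply: eq_fsbigr => V /set_mem /nn ->.
Qed.

Lemma gen_trunc U c : S U -> left_cosets (normalizer_in H U) U c -> S (gen_subgroup c).
Proof. exact: gen_coset_trunc. Qed.

Lemma gen_sub U c : S U -> left_cosets (normalizer_in H U) U c -> U `<=` gen_subgroup c.
Proof. by move=> SU [v _ <-]; apply: gen_coset_sub; exact: (trunc_fin SU).1. Qed.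

Lemma tghost_cong N n n' U : S U -> (forall V, S0 V -> cong_mul N (n V) (n' V)) ->
  cong_mul N (tghost n U) (tghost n' U).
Proof.
move=> SU nn; rewrite !(tghostE _ SU (@subset_refl _ U)).
apply: cong_fsum; first exact: finite_ghost_support.
move=> V [S0V _]; have SV := rep_trunc S0V.
apply: cong_ghost_term => //; [exact: trunc_fin|exact: trunc_subH|exact: repP|
  exact: trunc_fin|exact: nn].
Qed.

Lemma tfrob_sum_cong N a a' U : S U ->
  (forall K, S K -> cong_mul N (a K) (a' K)) ->
  cong_mul N (tfrob_sum a U) (tfrob_sum a' U).
Proof.
move=> SU aa; have fU := trunc_fin SU; apply: cong_fsum; first exact: finite_weyl.
move=> c cN; have SK := gen_trunc SU cN; have [z ->] := aa _ SK.
exists (tphi U z); rewrite tphiD ?tphiMn//; try exact: trunc_fin.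
  exact: gen_sub.
exact: gen_sub.
Qed.

Definition equivariant a := forall g K, H g -> S K ->
  tact g (conj_set g K) (a K) = a (conj_set g K).

Lemma tghost_equivariant n : equivariant (tghost n).
Proof.
move=> g K Hg' SK; have SK' := trunc_conj tS Hg' SK.
have fK := trunc_fin SK; have fK' := trunc_fin SK'.
have fS := finite_ghost_support SK.
rewrite (tghostE n SK (@subset_refl _ K)).
have sKK : ghost_support (conj_set g K) = ghost_support K.
  apply/seteqP; split=> V [S0V [_ [h [Hh hK] _]]]; split=> //.
    exists (left_coset (g^-1 * h) V), (g^-1 * h) => //; split.
      by apply: subgroupM => //; exact: subgroupV.
    by move: hK; rewrite conj_setM; gsimp.
  exists (left_coset (g * h) V), (g * h) => //; split; first exact: subgroupM.
  by rewrite conj_setM; gsimp.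
rewrite (tghostE n SK' (@subset_refl _ _)) sKK.
rewrite (linear_fsum _ fS (@tact_linear _ _ _ M g _ _ fK fK' erefl)).
apply: eq_fsbigr => V /set_mem [S0V _]; have SV := rep_trunc S0V.
apply: tact_ghost_term => //; [exact: trunc_fin|exact: trunc_subH|exact: repP].
Qed.

Lemma gen_coset_conj g v U : subgroup U -> conj_set g U = U ->
  conj_set g (gen_subgroup (left_coset v U)) =
  gen_subgroup (left_coset (g * v * g^-1) U).
Proof.
move=> Ug gU.
have sub w (k : G) : conj_set k U = U ->
    gen_subgroup (left_coset (k * w * k^-1) U) `<=`
    conj_set k (gen_subgroup (left_coset w U)).
  move=> kU; apply: gen_coset_min.
  - exact/conj_set_subgroup/subgroup_gen.
  - by exists w => //; exact: gen_coset_mem.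
  - by rewrite -{1}kU; apply: conj_setS; exact: gen_coset_sub.
apply/seteqP; split; last exact: sub.
have gU' : conj_set g^-1 U = U by rewrite -{1}gU conj_setM mulVg conj_set1.
have := sub (g * v * g^-1) g^-1 gU'; gsimp => h.
by have := conj_setS (g := g) h; rewrite conj_setM mulgV conj_set1.
Qed.

(** The action of [g] permutes the summands: conjugation sends the group generated by [vU] to the
    one generated by [g * v * g^-1 U]. *)
Lemma tfrob_sum_inv a U g : equivariant a -> S U -> normalizer_in H U g ->
  tact g U (tfrob_sum a U) = tfrob_sum a U.
Proof.
move=> aP SU Ng; have [Hg' gU] := Ng; have fU := trunc_fin SU; have Ug := fU.1.
have UH := trunc_subH SU; have fN := finite_weyl H fU.
have NNg := normalizer_subgroup U Hg.
pose f v := tphi U (a (gen_subgroup (left_coset v U))).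
have fE : tfrob_sum a U = (\sum_(c \in left_cosets (normalizer_in H U) U) f (coset_rep c))%R.
  apply: eq_fsbigr => c /set_mem cN; rewrite /f.
  by rewrite (left_coset_rep Ug cN).
have fact v : normalizer_in H U v -> tact g U (f v) = f (g * v * g^-1).
  move=> Nv; have cN : left_cosets (normalizer_in H U) U (left_coset v U) by exists v.
  have SK := gen_trunc SU cN; have SK' := trunc_conj tS Hg' SK.
  rewrite /f (@tact_phi _ _ _ M g _ _ U U _ (trunc_fin SK) (trunc_fin SK') fU fU) //.
    rewrite aP//; congr (tphi U (a _)); exact: gen_coset_conj.
  exact: gen_sub.
rewrite {1}fE (linear_fsum _ fN (@tact_linear _ _ _ M g _ _ fU fU (esym gU))) fE.
rewrite [RHS](@big_coset_reindex _ _ _ _ (normalizer_in H U) (normalizer_in H U) U U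
  (fun v => g * v * g^-1) f)//.
- by apply: eq_fsbigr => c /set_mem cN; apply: fact; exact: weyl_rep cN.
- move=> z u Uu; rewrite /f; congr (tphi U (a (gen_subgroup _))).
  by apply/left_coset_eq => //; gsimp; exact: subgroupV.
- by move=> v Nv; apply: subgroupM => //; [exact: subgroupM|exact: subgroupV].
- move=> v w; gsimp; rewrite -(mulgA g v^-1); split=> h.
    by have := normalizer_conjV Ng h; gsimp.
  by have := normalizer_conj Ng h; gsimp.
- move=> v Nv; exists (g^-1 * v * g).
    by apply: subgroupM => //; apply: subgroupM => //; exact: subgroupV.
  by gsimp; exact: subgroup1.
- move=> v u Nv Uu; apply: subgroupM => //; exact: normalizer_sub.
Qed.

Lemma ttransfer_fixed U (x : M U) : S U ->
  (forall g, normalizer_in H U g -> tact g U x = x) ->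
  ttransfer H x = (x *+ #|` fset_set (left_cosets (normalizer_in H U) U)|)%R.
Proof.
move=> SU xN; have fU := trunc_fin SU; have fN := finite_weyl H fU.
rewrite /ttransfer (eq_fsbigr (fun=> x)) => [|c /set_mem cN]; last first.
  by apply: xN; apply: weyl_rep cN => //; exact: trunc_subH.
by rewrite fsbig_finite//= big_const_seq count_predT iter_addr_0.
Qed.

Lemma ttransfer_fsum U (I : choiceType) (A : set I) (F : I -> M U) : S U ->
  finite_set A -> ttransfer H (\sum_(i \in A) F i)%R = (\sum_(i \in A) ttransfer H (F i))%R.
Proof.
move=> SU fA; have fU := trunc_fin SU; have UH := trunc_subH SU.
by rewrite !fsbig_finite//; apply: big_morph; [exact: ttransferD|exact: ttransfer0].
Qed.

Lemma effective_transfer V U (x : M V) : S0 V -> S U -> effective x ->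
  exists y : M U, ttransfer H y =
  (\sum_(c \in left_cosets (normalizer_in H U) U)
     tphi U (ghost_term H (rep (V := V)) (gen_subgroup c) x))%R.
Proof.
move=> S0V SU [l [lP xE]]; have SV := rep_trunc S0V; have fU := trunc_fin SU.
(* A point of [Y] is needed for the default of [nth]. If [Y] is empty there are no indices at all,
   and any two elements are equal. *)
have [[y0 _]|nY] := pselect (exists y : Y, True); last first.
  exists 0%R; apply: (tcoef_inj fU) => eta _; case: nY; by exists (eta 1).
pose d : T * (G -> Y) := (1%R, fun=> y0).
pose r (o : option 'I_(size l)) : T := if o is Some i then (nth d l i).1 else 1%R.
pose y (o : option 'I_(size l)) : G -> Y := if o is Some i then (nth d l i).2 else d.2.
have xE' : x = (\sum_i r (Some i) *: tbase M V (y (Some i)))%R.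
  by rewrite xE (big_nth d) big_mkord.
eexists; rewrite xE'; apply/esym/(@frob_sum_ghost_term _ _ _ _ _ _ Hg) => //.
- exact: trunc_fin.
- exact: trunc_subH.
- exact: repP.
- by move=> i; have [] := lP _ (mem_nth d (ltn_ord i)).
- by move=> k i; have [] := lP _ (mem_nth d (ltn_ord i)).
- exact: trunc_subH.
Qed.

Lemma tfrob_sum_ghost n U : S U -> exists x : M U, ttransfer H x = tfrob_sum (tghost n) U.
Proof.
move=> SU; have fU := trunc_fin SU; have Ug := fU.1; have UH := trunc_subH SU.
have fN := finite_weyl H fU; have fS := finite_ghost_support SU.
(* The modulus is the order of the Weyl group, nonzero because of the trivial coset. *)
have [N NE] : exists N, #|` fset_set (left_cosets (normalizer_in H U) U)| = N.+1.
  case E : #|` _| => [|N]; last by exists N.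
  have : left_coset 1 U \in fset_set (left_cosets (normalizer_in H U) U).
    rewrite in_fset_set//; apply/mem_set; exists 1 => //.
    by apply: subgroup1; exact: normalizer_subgroup.
  by move: E => /eqP; rewrite cardfs_eq0 => /eqP ->; rewrite inE.
pose n' V := xget 0%R [set x : M V | effective x /\ cong_mul N.+1 x (n V)].
have n'P V : S0 V -> effective (n' V) /\ cong_mul N.+1 (n' V) (n V).
  move=> S0V; have fV := trunc_fin (rep_trunc S0V).
  have [x ex cx] := effective_approx N (n V) fV.
  exact: (@xgetPex _ 0%R [set x : M V | effective x /\ cong_mul N.+1 x (n V)]
    (ex_intro _ x (conj ex cx))).
have [x xE] : exists x : M U, ttransfer H x = tfrob_sum (tghost n') U.
  pose P V (y : M U) := ttransfer H y =
    (\sum_(c \in left_cosets (normalizer_in H U) U)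
       tphi U (ghost_term H (rep (V := V)) (gen_subgroup c) (n' V)))%R.
  have /choice[y yE] : forall V, exists y, S0 V -> P V y.
    move=> V; have [S0V|] := pselect (S0 V); last by exists 0%R.
    by have [y yE] := effective_transfer S0V SU (n'P V S0V).1; exists y.
  exists (\sum_(V \in ghost_support U) y V)%R; rewrite ttransfer_fsum//.
  rewrite /tfrob_sum.
  rewrite (eq_fsbigr (fun V => \sum_(c \in left_cosets (normalizer_in H U) U)
       tphi U (ghost_term H (rep (V := V)) (gen_subgroup c) (n' V)))%R); last first.
    by move=> V /set_mem [S0V _]; exact: yE.
  rewrite exchange_fsbig//; apply: eq_fsbigr => c /set_mem cN.
  have SK := gen_trunc SU cN; have UK := gen_sub SU cN.
  by rewrite (tghostE _ SU UK) tphi_fsum//; exact: trunc_fin.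
have [y yE] : cong_mul N.+1 (tfrob_sum (tghost n') U) (tfrob_sum (tghost n) U).
  apply: tfrob_sum_cong => // K SK; apply: tghost_cong => // V S0V.
  by have [] := n'P V S0V.
(* Both Frobenius sums are invariant, hence so is [y *+ N.+1], and torsion-freeness allows
   cancelling [N.+1]. *)
have yN g : normalizer_in H U g -> tact g U y = y.
  move=> Ng; have lg : linear (@tact _ _ _ M g U U) by exact: tact_normal_linear Ng.
  have i1 := tfrob_sum_inv (tghost_equivariant n) SU Ng.
  have := tfrob_sum_inv (tghost_equivariant n') SU Ng.
  rewrite yE (linear_morphD lg) i1 => /addrI.
  rewrite -!scaler_nat (linear_morphZ _ _ lg) => /eqP.
  rewrite -subr_eq0 -scalerBr scaler_nat => /eqP h.
  by apply/subr0_eq; exact: tmod_torsion_free h.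
exists (x - y)%R; rewrite ttransferD//.
have -> : ttransfer H (- y)%R = (- (y *+ N.+1))%R.
  rewrite ttransfer_fixed// ?NE ?mulNrn// => g Ng.
  have lg : linear (@tact _ _ _ M g U U) by exact: tact_normal_linear Ng.
  by rewrite -scaleN1r (linear_morphZ _ _ lg) yN.
by rewrite xE yE addrK.
Qed.

(** Some conjugate of [U] lies in [V]. Equality would make [V] and [U] representatives of one class,
    hence equal. *)
Lemma ghost_support_index U V : S U -> ghost_support U V ->
  (gindex V <= gindex U)%N /\ (S0 U -> V <> U -> (gindex V < gindex U)%N).
Proof.
move=> SU sV; have fU := trunc_fin SU; have SV := rep_trunc sV.1.
have fV := trunc_fin SV; have [h [Hh SU' UV]] := ghost_supportP SU sV.
have fU' := trunc_fin SU'; rewrite -(gindex_conj h^-1 fU).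
split; first exact: gindex_le.
move=> S0U VU; have [VU'|[v [Vv nv]]] : V `<=` conj_set h^-1 U \/
    exists v, V v /\ ~ conj_set h^-1 U v.
- have [|nVU] := pselect (V `<=` conj_set h^-1 U); first by left.
  right; apply: contrapT => nv; apply: nVU => v Vv.
  by apply: contrapT => nUv; apply: nv; exists v.
- have VE : V = conj_set h^-1 U by apply/seteqP.
  have [W [_ Wu]] := S0P.2 _ SU; case: VU; rewrite -(Wu U); last first.
    by split=> //; exists 1; [exact: subgroup1|rewrite conj_set1].
  apply/esym/Wu; split; first exact: sV.1.
  by exists h^-1 => //; exact: subgroupV.
- exact: (gindex_lt fU' fV UV Vv nv).
Qed.

Lemma ghost_term_self U (x : M U) : S0 U ->
  ghost_term H (rep (V := U)) U x = ttransfer H x.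
Proof.
move=> S0U; have SU := rep_trunc S0U; have fU := trunc_fin SU; have Ug := fU.1.
have UH := trunc_subH SU.
(* A conjugate has the same finite index, so inclusion in [U] forces equality; the fixed cosets are
   therefore the Weyl group. *)
have hU h : H h -> conj_set h^-1 U `<=` U -> conj_set h U = U.
  move=> Hh hU; suff e : conj_set h^-1 U = U by rewrite -{1}e conj_setM mulgV conj_set1.
  apply/seteqP; split=> // u Uu; apply: contrapT => nu.
  have := gindex_lt (fin_subgroup_conj h^-1 fU) fU hU Uu nu.
  by rewrite gindex_conj// ltnn.
have FE : fixed_cosets H U U = left_cosets (normalizer_in H U) U.
  apply/seteqP; split=> _ [h [Hh hh] <-]; exists h => //; split=> //.
    exact: hU.
  by rewrite -{1}hh conj_setM mulVg conj_set1.
rewrite /ghost_term /ttransfer FE; apply: eq_fsbigr => C /set_mem CN.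
have [Hh hh] := weyl_rep Hg fU UH CN; set h := coset_rep C in Hh hh *.
have h'U : conj_set h^-1 U = U by rewrite -{1}hh conj_setM mulVg conj_set1.
have h'S : conj_set h^-1 U `<=` U by rewrite h'U.
apply: (tcoef_inj fU) => eta eU.
rewrite (tcoef_term fU (repP S0U))// (tcoef_act _ fU fU (esym hh))// h'U.
rewrite left_cosets_id// fsbig_set1; congr (tcoef _ x); apply/funext => z.
have UC : U (coset_rep U) by apply: (@xgetPex _ 1 U); exists 1; exact: subgroup1.
have eU' := right_inv_act (esym hh) eU.
rewrite (eU' _ _ UC); have := eU' z _ (subgroupV Ug (rep_mk_coset fU (repP S0U) z)).
by gsimp.
Qed.

(** * Solving for the components by induction on the index *)

Section Solve.
Variable a : forall V, M V.
Hypothesis aP : equivariant a.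
Hypothesis aT : forall U, S U -> exists x : M U, ttransfer H x = tfrob_sum a U.

(** Stage [k] chooses the components of index exactly [k] so that a transfer corrects the current
    ghost component. The default 0 is taken when no correction exists. *)
Definition solve_step k n V : M V :=
  if gindex V == k then xget 0%R [set x : M V | ttransfer H x = a V - tghost n V]%R
  else n V.

Fixpoint solve k : forall V, M V :=
  if k is k'.+1 then solve_step k' (solve k') else fun=> 0%R.

Lemma solve0 k V : (k <= gindex V)%N -> solve k V = 0%R.
Proof.
elim: k => [//|k ih kV] /=; rewrite /solve_step.
by rewrite gtn_eqF// ih// ltnW.
Qed.

Lemma solve_stable k V : (gindex V < k)%N -> solve k V = solve (gindex V).+1 V.
Proof.
elim: k => [//|k ih]; rewrite ltnS leq_eqVlt => /orP[/eqP ->//|kV].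
by rewrite -ih//= /solve_step ltn_eqF.
Qed.

Lemma gen_coset_lt U c : S U -> left_cosets (normalizer_in H U) U c -> c <> U ->
  (gindex (gen_subgroup c) < gindex U)%N.
Proof.
move=> SU cN cU; have fU := trunc_fin SU; have SK := gen_trunc SU cN.
have [v [Hv vU] vE] := cN; apply: (gindex_lt fU (trunc_fin SK) (gen_sub SU cN) (v := v)).
  by rewrite -vE; exact: gen_coset_mem fU.1.
by move=> Uv; apply: cU; rewrite -vE; exact: left_coset_id fU.1 Uv.
Qed.

Lemma tphi_gen_self b U : S U -> tphi U (b (gen_subgroup U)) = b U :> M U.
Proof.
move=> SU; have fU := trunc_fin SU.
have -> : gen_subgroup U = U.
  apply/seteqP; split=> z; first by apply; [exact: fU.1|].
  by move=> Uz K _; apply.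
exact: tphi_id.
Qed.

(** Every nontrivial coset generates a group of smaller index, where [a] and [b] agree, so only the
    trivial coset survives, on which the Frobenius lift is the identity. *)
Lemma tfrob_sum_diff b U : S U ->
  (forall K, S K -> (gindex K < gindex U)%N -> b K = a K) ->
  (tfrob_sum a U - tfrob_sum b U = a U - b U)%R.
Proof.
move=> SU ba; have fU := trunc_fin SU; have Ug := fU.1; have fN := finite_weyl H fU.
have UN : left_cosets (normalizer_in H U) U U.
  exists 1; first by apply: subgroup1; exact: normalizer_subgroup.
  by apply: left_coset_id => //; exact: subgroup1.
rewrite /tfrob_sum !(fsbigD1 U _ _ fN UN) !tphi_gen_self//=.
rewrite (eq_fsbigr (fun c => tphi U (b (gen_subgroup c)))); last first.
  move=> c /set_mem [cN cU].
  by rewrite ba//; [exact: gen_trunc cN|exact: gen_coset_lt].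
by rewrite opprD addrACA subrr addr0.
Qed.

Lemma tghost_solve k U : S U -> (gindex U < k)%N -> tghost (solve k) U = a U.
Proof.
elim: k U => [//|k ih] U SU; rewrite ltnS leq_eqVlt => /orP[/eqP Uk|Uk]; last first.
  (* Components contributing at [U] have index at most that of [U], hence below [k], and stage [k]
     leaves them alone. *)
  rewrite -(ih U)//; apply: tghost_eq => // V /(ghost_support_index SU)[VU _].
  by rewrite /= /solve_step ltn_eqF// (leq_ltn_trans VU).
have [U0 [[S0U0 [h Hh U0E]] _]] := S0P.2 _ SU.
(* Both sides are equivariant, so agreement at the class representative gives agreement at [U]. *)
suff E : tghost (solve k.+1) U0 = a U0.
  have SU0 := rep_trunc S0U0; have Hh' := subgroupV Hg Hh.
  have UE : conj_set h^-1 U0 = U by rewrite U0E conj_setM mulVg conj_set1.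
  have := aP Hh' SU0; have := tghost_equivariant (solve k.+1) Hh' SU0.
  by rewrite E UE => -> .
have fU := trunc_fin SU; have U0k : gindex U0 = k by rewrite U0E gindex_conj.
move: {U SU Uk h Hh U0E fU} U0 S0U0 U0k => U S0U Uk.
have SU := rep_trunc S0U; have fU := trunc_fin SU; have UH := trunc_subH SU.
have fS := finite_ghost_support SU.
have sU : ghost_support U U.
  split=> //; exists (left_coset 1 U), 1 => //; split; first exact: subgroup1.
  by rewrite invg1 conj_set1.
have [x xE] : exists x : M U, ttransfer H x = (a U - tghost (solve k) U)%R.
  (* Both Frobenius sums are transfers, and by induction their difference is the difference of the
     components at [U]. *)
  have [x1 x1E] := aT SU; have [x2 x2E] := tfrob_sum_ghost (solve k) SU.
  exists (x1 - x2)%R; rewrite -(tfrob_sum_diff (b := tghost (solve k)) SU).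
    apply/eqP; rewrite eq_sym subr_eq -x2E -x1E -ttransferD// subrK//.
  by move=> K SK KU; apply: ih => //; rewrite -Uk.
have xE' : ttransfer H (solve k.+1 U) = (a U - tghost (solve k) U)%R.
  rewrite /= /solve_step Uk eqxx.
  exact: (@xgetPex _ 0%R [set x : M U | ttransfer H x = a U - tghost (solve k) U]%R
    (ex_intro _ x xE)).
move: xE'; rewrite !(tghostE _ SU (@subset_refl _ U)) !(fsbigD1 U _ _ fS sU) /=.
rewrite -/(solve k.+1) !ghost_term_self// => ->.
(* Before stage [k] the component at [U] is 0, so its new summand is exactly the missing transfer;
   the other contributing [V] have smaller index. *)
rewrite (@solve0 k U) ?Uk// (ttransfer0 M Hg fU UH) add0r.
rewrite [X in (_ + X)%R](eq_fsbigr
  (fun V => ghost_term H (rep (V := V)) U (solve k V))) /= ?subrK//.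
move=> V /set_mem [sV VU]; have [_ VU'] := ghost_support_index SU sV.
by rewrite /= /solve_step ltn_eqF// -Uk; exact: VU'.
Qed.

End Solve.

Theorem tensor_dwork a : equivariant a ->
  (exists n, forall U, S U -> tghost n U = a U) <->
  (forall U, S U -> exists x : M U, ttransfer H x = tfrob_sum a U).
Proof.
move=> aP; split=> [[n na] U SU|aT].
  have [x xE] := tfrob_sum_ghost n SU; exists x; rewrite xE.
  apply: eq_fsbigr => c /set_mem cN.
  by rewrite na//; exact: gen_trunc cN.
(* Each component is taken just after the stage that fixes it; later stages agree by
   [solve_stable]. *)
exists (fun V => solve a (gindex V).+1 V) => U SU.
rewrite -(tghost_solve aP aT SU (ltnSn _)); apply: tghost_eq => // V sV.
by rewrite [RHS]solve_stable// ltnS; have [] := ghost_support_index SU sV.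
Qed.

End Dwork.

(** * The tensor powers of a free module *)

Section FreeScalars.
Variable X : choiceType.
Local Notation T := (freeCRing X).
Local Open Scope ring_scope.

Lemma frob_monom k (m : {cmonom X}) : frob k << m >> = << m >> ^+ k.
Proof. by rewrite /frob /= mmapU mul1r. Qed.

Lemma monom_mulrz (m : {cmonom X}) (c : int) : << c *g m >> = << m >> *~ c :> T.
Proof.
apply/malgP => k; rewrite mcoeffU raddfMz /= mcoeffU.
by case: (m == k); rewrite ?mul0rz// intz.
Qed.

(** Monomials generate the additive group of [T], and on them [frob k] is the [k]-th power. *)
Lemma free_scalar_ind (P : T -> Prop) :
  (forall r s, P r -> P s -> P (r + s)) -> (forall r, P r -> P (- r)) ->
  (forall r, (forall k, frob k r = r ^+ k) -> P r) -> forall r, P r.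
Proof.
move=> PD PN Pf r.
have P0 : P 0.
  have P1 : P 1 by apply: Pf => k; rewrite rmorph1 expr1n.
  by rewrite -(subrr 1); apply: PD => //; exact: PN.
have PM s n : P s -> P (s *+ n).
  by move=> Ps; elim: n => [|n ih]; rewrite ?mulr0n// mulrS; exact: PD.
rewrite [r]monalgE; apply: big_ind => // m _; rewrite monom_mulrz.
have Pm : P << m >> by apply: Pf => k; exact: frob_monom.
by case: (r@_m) => n; [exact: PM|apply: PN; exact: PM].
Qed.

Lemma frob1 (r : T) : frob 1 r = r.
Proof.
rewrite [in RHS](monalgE r) [in LHS](monalgE r) rmorph_sum; apply: eq_bigr => m _.
by rewrite monom_mulrz rmorphMz; congr (_ *~ _); rewrite -[RHS]expr1; exact: frob_monom.
Qed.

Lemma free_scalar_torsion_free n (r : T) : r *+ n.+1 = 0 -> r = 0.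
Proof.
move=> r0; apply/malgP => m; have := congr1 (mcoeff m) r0.
by rewrite mcoeffMn !mcoeff0 => /eqP; rewrite Num.Theory.mulrn_eq0 => /eqP.
Qed.

End FreeScalars.

Section Instance.
Variables (G : profiniteGroupType) (X Y : choiceType).
Local Notation T := (freeCRing X).
Local Notation Q := {malg T[Y]}.

Definition QG_system : tensor_system G Y T :=
  {| tmod := fun U => tpow Q (left_cosets [set: G] U);
     tcoef := fun U eta => coef (U := U) eta;
     tbase := fun U => gtens X U;
     tact := fun g V V' => tensor_act g V';
     tfrob := fun k => frob k;
     tphi := fun V U => frob_lift U;
     tpower := fun V U rep n => fGV rep (tens_power (left_cosets V U) n);
     tcoef_linear := fun U eta fU => coef_linear eta fU;
     tcoef_inj := fun U x y fU => @coef_inj G X Y U x y fU;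
     tcoef_base := fun U eta eta' fU eU eU' => coef_gtens X fU eU eU';
     tbase_expand := fun U x fU => gtens_expand x fU;
     tact_linear := fun g V V' fV fV' V'E => @tensor_act_linear G X Y g V V' fV fV' V'E;
     tcoef_act := fun g V V' eta x fV fV' V'E eV' => coef_act fV fV' V'E x eV';
     tcoef_phi := fun V U eta x fV fU UV eU => coef_frob_lift fV fU UV x eU;
     tcoef_power := fun V U rep eta n fV fU UV repP eU =>
       coef_power fV fU UV repP n eU;
     tfrob1 := @frob1 X;
     tscalar_ind := @free_scalar_ind X;
     tscalar_torsion_free := @free_scalar_torsion_free X |}.

End Instance.

(** Turns a family over the subtype [A] into a total one, so that subgroups can be substituted
    without carrying membership proofs. *)
Definition extend (T : Type) (A : set T) (P : T -> Type) (d : forall x, P x)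
    (f : forall x : A, P (set_val x)) (x : T) : P x :=
  if pselect (A x) is left p then f (SigSub (mem_set p)) else d x.

Lemma extendE (T : Type) (A : set T) (P : T -> Type) (d : forall x, P x)
    (f : forall x : A, P (set_val x)) (x : A) :
  extend d f (set_val x) = f x.
Proof.
rewrite /extend; case: pselect => [p|[]]; last exact: set_valP.
case: x p => x xA p /=; congr (f (exist _ x _)); exact: bool_irrelevance.
Qed.

Lemma extend_in (T : Type) (A : set T) (P : T -> Type) (d : forall x, P x)
    (f : forall x : A, P (set_val x)) (x : T) (p : x \in A) :
  extend d f x = f (SigSub p).
Proof. exact: (extendE d f (SigSub p)). Qed.

Theorem lemma3p11 (G : profiniteGroupType) (H : set G)
  (Hg : subgroup H) (oH : open H)
  (S : set (set G)) (tS : truncation_set H S)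
  (S0 : set (set G)) (S0P : conj_representatives H S S0)
  (rep : forall V : S0, left_cosets [set: G] (set_val V) -> G)
  (repP : forall (V : S0) (c : left_cosets [set: G] (set_val V)),
    set_val c (rep V c))
  (X Y : choiceType)
  (a : forall U : S, QG X Y (set_val U)) (aP : ghost_group H a) :
  range (ghost H (S := S) rep) a <->
  forall U : S,
    range (transfer H (U := set_val U)) (frob_sum Hg tS a U).
Proof.
pose M := QG_system G X Y.
pose P V := left_cosets [set: G] V -> G.
pose rep' : forall V, P V := extend (P := P) (fun V c => coset_rep (set_val c)) rep.
pose a' : forall V, M V := extend (P := fun V => M V) (fun V => 0%R) a.
have rep'P V : S0 V -> forall c, set_val c (rep' V c).
  move=> S0V; have E := extend_in (P := P) (fun V c => coset_rep (set_val c)) rep (mem_set S0V).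
  move=> c; exact: (eq_ind_r (fun f : P V => set_val c (f c))
    (repP (SigSub (mem_set S0V)) c) E).
have a'P : equivariant H S a'.
  move=> g K Hg' SK; have SK' := trunc_conj tS Hg' SK.
  have E K0 (SK0 : S K0) : a' K0 = a (SigSub (mem_set SK0)).
    exact: (extend_in (P := fun V => M V) (fun V => 0%R) a (mem_set SK0)).
  rewrite (E _ SK) (E _ SK').
  exact: (aP g (SigSub (mem_set SK)) (SigSub (mem_set SK')) Hg' erefl).
have D := tensor_dwork Hg tS S0P rep'P a'P.
(* Sums over the subtypes are rewritten as sums over the sets, on which the extended families keep
   their original values. *)
have gE (n : forall V : S0, QG X Y (set_val V)) (n' : forall V, M V) (U : S) :
    (forall V : S0, n' (set_val V) = n V) ->
    tghost H S0 rep' n' (set_val U) = ghost H rep n U.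
  move=> nn; rewrite /tghost /ghost -big_set_type.
  apply: eq_fsbigr => V _; rewrite /ghost_term.
  apply: eq_fsbigr => c _.
  by rewrite nn /rep' (extendE (P := P) _ rep V).
have fE (U : S) : tfrob_sum H a' (set_val U) = frob_sum Hg tS a U.
  rewrite /tfrob_sum /frob_sum -big_set_type; apply: eq_fsbigr => c _.
  congr (frob_lift _ _).
  exact: (extend_in (P := fun V => M V) (fun V => 0%R) a (mem_set _)).
split=> [[n _ na] U|h].
  have ex : exists n : forall V, M V, forall U, S U -> tghost H S0 rep' n U = a' U.
    pose n' : forall V, M V := extend (P := fun V => M V) (fun V => 0%R) n.
    exists n' => {}U SU; rewrite -[U]/(set_val (SigSub (mem_set SU))).
    rewrite (gE n n' (SigSub (mem_set SU))) ?na.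
      exact: esym (extendE (P := fun V => M V) (fun V => 0%R) a (SigSub (mem_set SU))).
    by move=> V; exact: (extendE (P := fun V => M V) (fun V => 0%R) n).
  have [x xE] := D.1 ex (set_val U) (set_valP U).
  by exists x => //; exact: etrans xE (fE U).
have [U SU|n nE] := D.2.
  by have [x _ xE] := h (SigSub (mem_set SU)); exists x; exact: etrans xE (esym (fE _)).
exists (fun V : S0 => n (set_val V)) => //.
apply: functional_extensionality_dep => U.
rewrite -(gE _ n) // nE; last exact: set_valP.
exact: (extendE (P := fun V => M V) (fun V => 0%R) a U).
Qed.
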